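(* Let $n$ be a positive integer and let $M$ be a non-totally geodesic rotational hypersurface in $\mathbb{H}^{2n+1}$. Then $M$ is minimal if and only if its generating curve $\gamma$, locally, satisfies the Euler--Lagrange equation $$(u')^2=\frac{4u^2}{(2n-1)^2}\left(-u^{2n}+4n^2a\,u+(2n-1)^2\right),\qquad u=\kappa^{1/n},$$ associated to the $p$-energy functional $$\mathbf{\Theta}_p(\gamma)=\int_\gamma\kappa^p\,ds,$$ for $p=\frac{2n-1}{2n}\in[1/2,1)$ and $a>0$. Furthermore, the rotational hypersurface $M$ is the warped product hypersurface $\gamma\times_f\mathbb{S}^{2n-1}$, where the warping function $f$ is given by $$f=\frac{2n-1}{c\,\kappa^{1/(2n)}}=\frac{2n-1}{c\,\sqrt{u}},$$ for $c=2n\sqrt{a}>0$. (Hence, the metric on $M$ is $ds^2+f^2(s)\,\overline{g}$, where $\overline{g}$ is the round metric on $\mathbb{S}^{2n-1}$.)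
   Context: Hyperbolic space is the hyperboloid $\mathbb{H}^{2n+1}=\{(x_1,\dots,x_{2n+1},z)\in\mathbb{R}^{2n+2}: \sum_{i=1}^{2n+1}x_i^2-z^2=-1,\ z>0\}$ with the Riemannian metric induced by $\sum_i dx_i^2-dz^2$. The hyperbolic plane $\mathbb{H}^2$ is regarded as the totally geodesic surface of $\mathbb{H}^{2n+1}$ where only $x_1$, $x_{2n+1}$ and $z$ may be nonzero. A (spherical) rotational hypersurface of $\mathbb{H}^{2n+1}$ is a hypersurface invariant under the orthogonal group $O(2n)$ acting on the coordinates $(x_1,\dots,x_{2n})$; it is the evolution under $O(2n)$ of a curve $\gamma\subset\mathbb{H}^2$ (the generating curve) parameterized by arc length $s$. $\kappa$ is the curvature of $\gamma$ in $\mathbb{H}^2$, and a prime denotes the derivative with respect to $s$. The functional $\mathbf{\Theta}_p$ acts on convex curves immersed in $\mathbb{H}^2$ (so $\kappa>0$). ''Euler--Lagrange equation'' of $\mathbf{\Theta}_p$ refers to the displayed first-order ODE for curves of non-constant curvature; it is a first integral of the proper Euler--Lagrange equation, and the two are equivalent when $\kappa$ is not constant. The constant $a$ in the definition of $c$ is the one appearing in this ODE. $M$ is minimal if its mean curvature vanishes identically.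
   Formalization: Since the equation fixes γ only up to isometries of the hyperbolic plane, it gives minimality of M only if M is also the warped product with the stated f; otherwise it is shown that some isometry moves γ to a curve generating such a minimal hypersurface. *)

(* Defs.v *)
From HB Require Import structures.
From mathcomp Require Import all_boot all_order all_algebra.
From mathcomp Require Import all_classical all_reals all_analysis.
Import numFieldNormedType.Exports.
Set Implicit Arguments.
Unset Strict Implicit.
Unset Printing Implicit Defensive.
Import Order.TTheory GRing.Theory Num.Theory.
Local Open Scope classical_set_scope.
Local Open Scope ring_scope.

Section HyperbolicSpace.
Variable R : realType.

Definition dot d (u v : 'rV[R]_d) : R := \sum_i u 0 i * v 0 i.

(* The last coordinate, split off by lsubmx / rsubmx, is the timelike one. *)
Definition lorentz d (u v : 'rV[R]_(d + 1)) : R :=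
  dot (lsubmx u) (lsubmx v) - dot (rsubmx u) (rsubmx v).

Definition hyperbolic d : set 'rV[R]_(d + 1) :=
  [set p | lorentz p p = -1 /\ 0 < rsubmx p 0 0].

(* The isometries of the hyperboloid are the maps p |-> p *m L, with L a
   linear Lorentz transformation preserving the sheet z > 0. *)
Definition hyperbolic_isometry d (L : 'M[R]_(d + 1)) : Prop :=
  (forall u v : 'rV_(d + 1), lorentz (u *m L) (v *m L) = lorentz u v) /\
  (forall p : 'rV_(d + 1), @hyperbolic d p -> @hyperbolic d (p *m L)).

End HyperbolicSpace.

Section Smoothness.
Variables (R : realType) (d : nat) (V : normedModType R).

Fixpoint Ck (k : nat) (U : set 'rV[R]_d) (f : 'rV[R]_d -> V) : Prop :=
  if k is k'.+1 then
    forall i, (forall q, U q -> derivable f q 'e_i) /\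
              Ck k' U (fun q => 'D_'e_i f q)
  else forall q, U q -> {for q, continuous f}.

Definition smooth_on (U : set 'rV[R]_d) (f : 'rV[R]_d -> V) : Prop :=
  forall k, Ck k U f.

End Smoothness.

Section Hypersurface.
Variables (R : realType) (m : nat).
(* X is a (local) parametrization of a hypersurface of H^(m+1), which lies in
   R^(m+2). *)
Variable X : 'rV[R]_m -> 'rV[R]_(m + 1 + 1).

Definition immersed_at (q : 'rV[R]_m) : Prop :=
  row_free (\matrix_(i < m) 'D_'e_i X q).

Definition first_form (q : 'rV[R]_m) : 'M[R]_m :=
  \matrix_(i, j) lorentz ('D_'e_i X q) ('D_'e_j X q).

(* Orthogonality to X q says that nu is tangent to the hyperboloid. *)
Definition unit_normal (q : 'rV[R]_m) (nu : 'rV[R]_(m + 1 + 1)) : Prop :=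
  [/\ lorentz nu nu = 1, lorentz nu (X q) = 0 &
      forall i, lorentz nu ('D_'e_i X q) = 0].

(* The Levi-Civita connection of the hyperboloid differs from the flat one by a
   multiple of the position vector X q, to which nu is orthogonal; hence flat
   second derivatives suffice here. *)
Definition second_form (q : 'rV[R]_m) (nu : 'rV[R]_(m + 1 + 1)) : 'M[R]_m :=
  \matrix_(i, j) lorentz ('D_'e_i (fun q' => 'D_'e_j X q') q) nu.

Definition mean_curvature (q : 'rV[R]_m) (nu : 'rV[R]_(m + 1 + 1)) : R :=
  m%:R^-1 * \tr (invmx (first_form q) *m second_form q nu).

End Hypersurface.

Section PlaneCurve.
Variable R : realType.
Implicit Types (I : set R) (gamma : R -> 'rV[R]_(2 + 1)).

(* The hyperbolic plane has coordinates (x_1, x_(2n+1), z). *)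
Definition arc_length_curve I gamma : Prop :=
  forall s, I s ->
  [/\ forall k, derivable (derive1n k gamma) s 1,
      @hyperbolic R 2 (gamma s)
    & lorentz (derive1 gamma s) (derive1 gamma s) = 1].

(* The covariant derivative of gamma' in H^2: the projection of gamma'' to the
   tangent plane of the hyperboloid at gamma. *)
Definition acceleration gamma (s : R) : 'rV[R]_(2 + 1) :=
  derive1n 2 gamma s + lorentz (derive1n 2 gamma s) (gamma s) *: gamma s.

Definition curvature gamma (s : R) : R :=
  Num.sqrt (lorentz (acceleration gamma s) (acceleration gamma s)).

Definition u_of (n : nat) gamma (s : R) : R := curvature gamma s `^ (n%:R^-1).

(* The equation is the first integral
     ((p k^(p-1))')^2 + ((p-1) k^p)^2 - (p k^(p-1))^2 = a,  k = curvature,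
   of the Euler-Lagrange equation of the integral of k^p for
   p = (2n-1)/(2n), rewritten for u = k^(1/n); the constant curvature solutions
   of the first integral are discarded, since they are not critical curves in
   general. *)
Definition euler_lagrange (n : nat) (a : R) I gamma : Prop :=
  let u := u_of n gamma in
  [/\ forall s, I s -> 0 < curvature gamma s,
      exists s t, [/\ I s, I t & curvature gamma s != curvature gamma t]
    & forall s, I s ->
        derivable u s 1 /\
        derive1 u s ^+ 2 =
          4 * u s ^+ 2 / (2 * n%:R - 1) ^+ 2 *
          (- u s ^+ (2 * n) + 4 * n%:R ^+ 2 * a * u s + (2 * n%:R - 1) ^+ 2)].

End PlaneCurve.

Section Rotational.
Variables (R : realType) (n : nat).
Implicit Types (I : set R) (gamma : R -> 'rV[R]_(2 + 1)) (f : R -> R).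

(* The O(2n)-orbit of the point p = (x_1, x_(2n+1), z) of H^2, that is of
   (x_1, 0, ..., 0, x_(2n+1), z), consists of the points rotate p theta with
   theta in the unit sphere of R^(2n). *)
Definition rotate (p : 'rV[R]_(2 + 1)) (theta : 'rV[R]_(2 * n)) :
    'rV[R]_(2 * n + 1 + 1) :=
  row_mx (row_mx (p 0 (inord 0) *: theta) (p 0 (inord 1))%:M)
         (p 0 (inord 2))%:M.

(* A smooth map (sigma, theta) from an open subset U of R^(2n) to
   I x S^(2n-1). *)
Definition smooth_patch I (U : set 'rV[R]_(2 * n))
    (sigma : 'rV[R]_(2 * n) -> R)
    (theta : 'rV[R]_(2 * n) -> 'rV[R]_(2 * n)) : Prop :=
  [/\ open U, smooth_on U sigma, smooth_on U theta
    & forall q, U q -> I (sigma q) /\ dot (theta q) (theta q) = 1].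

Definition rot_map gamma sigma theta (q : 'rV[R]_(2 * n)) :
    'rV[R]_(2 * n + 1 + 1) :=
  rotate (gamma (sigma q)) (theta q).

(* The rotational hypersurface generated by gamma on I is the immersed
   hypersurface (s, theta) |-> rotate (gamma s) theta; its local
   parametrizations are the immersions among the maps rot_map.  There are none
   at the points where gamma meets the axis x_1 = 0. *)
Definition totally_geodesic I gamma : Prop :=
  forall U sigma theta, smooth_patch I U sigma theta ->
  forall q, U q -> immersed_at (rot_map gamma sigma theta) q ->
  forall nu, unit_normal (rot_map gamma sigma theta) q nu ->
  second_form (rot_map gamma sigma theta) q nu = 0.

Definition minimal I gamma : Prop :=
  forall U sigma theta, smooth_patch I U sigma theta ->
  forall q, U q -> immersed_at (rot_map gamma sigma theta) q ->
  forall nu, unit_normal (rot_map gamma sigma theta) q nu ->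
  mean_curvature (rot_map gamma sigma theta) q nu = 0.

(* The metric induced by (s, theta) |-> rotate (gamma s) theta is
   ds^2 + f(s)^2 g, with g the round metric of S^(2n-1) and f > 0. *)
Definition warped_product I gamma f : Prop :=
  (forall s, I s -> 0 < f s) /\
  (forall U sigma theta, smooth_patch I U sigma theta ->
   forall q, U q ->
   first_form (rot_map gamma sigma theta) q =
     \matrix_(i, j) ('D_'e_i sigma q * 'D_'e_j sigma q +
       f (sigma q) ^+ 2 * dot ('D_'e_i theta q) ('D_'e_j theta q))).

Definition warping (a : R) gamma (s : R) : R :=
  let c := 2 * n%:R * Num.sqrt a in
  (2 * n%:R - 1) / (c * curvature gamma s `^ ((2 * n%:R)^-1)).

End Rotational.

(* Main.v *)
Require Import Defs.
From mathcomp Require Import all_boot all_order all_algebra.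
From mathcomp Require Import all_classical all_reals all_analysis.
From mathcomp Require Import ring lra.
Import numFieldNormedType.Exports.
Import Order.TTheory GRing.Theory Num.Theory.
Set Implicit Arguments.
Unset Strict Implicit.
Unset Printing Implicit Defensive.
Local Open Scope classical_set_scope.
Local Open Scope ring_scope.

(** A rotational hypersurface has two principal curvatures: the curvature k of
    the generating curve gamma, and - N_1 / x with multiplicity 2 n - 1, where x
    is the first coordinate of gamma and N_1 that of its unit normal. So
    minimality is the profile equation k x = (2 n - 1) N_1 off the axis x = 0
    (minimal_profile), while the induced metric is ds^2 + x^2 g, so that the
    warping function is the absolute value of x (warped_product_sqr).

    From minimality to the Euler-Lagrange equation: since N_1' = - k x', the
    profile equation has the first integral N_1 x^(2n-1). If the hypersurface is
    not totally geodesic, its value is nonzero, so x never vanishes, the curvature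
    is a constant multiple of x^(-2n), and u = k^(1/n) is a multiple of x^(-2).
    The expansion of the constant unit vector along the x_1-axis in the moving
    frame gives x'^2 + N_1^2 = 1 + x^2, and this is the Euler-Lagrange equation
    for a determined by the first integral (profile_euler_lagrange).

    Conversely, let f be the warping function built from the curvature of a
    solution, and m = 2 n - 1. The Euler-Lagrange equation reads
    f'^2 + (k f / m)^2 = 1 + f^2 (warping_first_integral), and its derivative
    gives f'' = f + k^2 f / m (warping_second_order). This derivation divides by
    f', and intervals on which f' vanishes are excluded by a continuity argument
    (first_integral_second_order). Together with k' f = - 2 n k f', the last
    equation means that the vector with components f', k f / m and - f in the
    moving frame is constant (axis_constant). It is a unit vector, and an isometry maps it to the x_1-axis
    (isometry_to_axis); for the image curve x = f, and the equation for f'' is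
    the profile equation up to the factor k (second_order_profile_eq).

    The passage between hypersurface and profile rests on two points. The
    fundamental forms of all parametrizations are computed at once from partial
    derivatives, and the trace of the shape operator comes from completing the
    tangent space to a frame (rot_trace). And every point of the curve lies on a
    smooth patch, given by inverse stereographic projection
    (smooth_patch_exists). *)

(** * Derivatives and intervals of the line *)

Section Derivatives.
Variables (R : realType) (V : normedModType R).
Implicit Types (q v : V) (f g : V -> R).

Lemma is_derive_ptD f g q v (df dg : R) : is_derive q v f df -> is_derive q v g dg ->
  is_derive q v (fun p => f p + g p) (df + dg).
Proof. exact: is_deriveD. Qed.

Lemma is_derive_ptB f g q v (df dg : R) : is_derive q v f df -> is_derive q v g dg ->
  is_derive q v (fun p => f p - g p) (df - dg).
Proof. exact: is_deriveB. Qed.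

Lemma is_derive_ptM f g q v (df dg : R) : is_derive q v f df -> is_derive q v g dg ->
  is_derive q v (fun p => f p * g p) (df * g q + f q * dg).
Proof.
move=> hf hg; have h := is_deriveM hf hg.
have -> : df * g q + f q * dg = f q *: dg + g q *: df.
  by rewrite /GRing.scale /= addrC [df * _]mulrC.
exact: h.
Qed.

Lemma is_derive_ptV f q v (df : R) : f q != 0 -> is_derive q v f df ->
  is_derive q v (fun p => (f p)^-1) (- df / f q ^+ 2).
Proof.
move=> fq0 [df1 df2]; split; first exact: derivableV.
by rewrite deriveV // df2 /GRing.scale /= !mulNr mulrC.
Qed.

Lemma is_derive_pt_sum n (F : 'I_n -> V -> R) (dF : 'I_n -> R) q v :
  (forall i, is_derive q v (F i) (dF i)) ->
  is_derive q v (fun p => \sum_i F i p) (\sum_i dF i).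
Proof.
move=> dh; have := is_derive_sum dh; congr (is_derive _ _ _ _).
by apply/funext => p; rewrite fct_sumE.
Qed.

(** Directional derivatives are derivatives in one real variable, where
    derivable functions are differentiable. The chain rule below therefore needs
    no total differentiability of the inner function. *)
Lemma is_derive_line (W : normedModType R) (f : V -> W) q v df :
  is_derive q v f df <->
  is_derive (0 : R) 1 (fun h : R => f (h *: v + q)) df.
Proof.
have E : 'D_v f q = 'D_1 (fun h : R => f (h *: v + q)) 0.
  rewrite /derive; set g1 := fun h => h^-1 *: _; set g2 := fun h => h^-1 *: _.
  suff -> : g1 = g2 by [].
  by apply/funext => h; rewrite /g1 /g2 /= addr0 scale0r add0r [_%:A]mulr1.
have [P1 P2] := derivable1P f q v.
by split=> -[d1 <-]; split => //; [exact: P1|exact: P2].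
Qed.

Lemma is_derive_chain (g : R -> R) f q v (dg df : R) :
  is_derive (f q) 1 g dg -> is_derive q v f df ->
  is_derive q v (fun p => g (f p)) (dg * df).
Proof.
move=> hg /is_derive_line hf; apply/is_derive_line.
apply: (@is_derive1_comp R g (fun h : R => f (h *: v + q))) => //.
by rewrite scale0r add0r.
Qed.

Lemma is_derive_mx m n (M : V -> 'M[R]_(m, n)) (dM : 'M[R]_(m, n)) q v :
  (forall i j, is_derive q v (fun p => M p i j) (dM i j)) ->
  is_derive q v M dM.
Proof.
move=> dMij; have dM1 : derivable M q v by apply/derivable_mxP => i j; case: (dMij i j).
split=> //; rewrite derive_mx //; apply/matrixP => i j; rewrite mxE.
by case: (dMij i j).
Qed.

Lemma is_derive_coord m n (M : V -> 'M[R]_(m, n)) (dM : 'M[R]_(m, n)) q v i j :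
  is_derive q v M dM -> is_derive q v (fun p => M p i j) (dM i j).
Proof.
move=> [dM1 <-]; split; first by move: dM1 => /derivable_mxP.
by rewrite derive_mx // mxE.
Qed.

Lemma is_derive_local (W : normedModType R) (U : set V) (f g : V -> W) q v df :
  open U -> U q -> (forall p, U p -> f p = g p) ->
  is_derive q v f df -> is_derive q v g df.
Proof.
move=> oU Uq fg; apply: near_eq_is_derive.
by apply: filterS (open_nbhs_nbhs (conj oU Uq)) => p /fg.
Qed.

Lemma is_derive_unique (W : normedModType R) (f : V -> W) q v d1 d2 :
  is_derive q v f d1 -> is_derive q v f d2 -> d1 = d2.
Proof. by move=> [_ <-] [_ <-]. Qed.

Lemma is_derive_local_cst (W : normedModType R) (U : set V) (f : V -> W) c q v df :
  open U -> U q -> (forall p, U p -> f p = c) ->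
  is_derive q v f df -> df = 0.
Proof.
move=> oU Uq fc hf.
have hc : is_derive q v (cst c) df by exact: (is_derive_local oU Uq fc hf).
exact: is_derive_unique hc (is_derive_cst _ _ _).
Qed.

End Derivatives.

Section Intervals.
Variables (R : realType) (I : set R).
Hypothesis I_itv : is_interval I.

Lemma is_derive_continuous (f : R -> R) (s df : R) :
  is_derive s 1 f df -> {for s, continuous f}.
Proof. by move=> [d _]; apply: differentiable_continuous; apply/derivable1_diffP. Qed.

Lemma segment_within (f : R -> R) s t : I s -> I t ->
  (forall r, I r -> {for r, continuous f}) -> {within `[s, t], continuous f}.
Proof.
move=> Is It cf; apply: continuous_in_subspaceT => r /set_mem /=.
by rewrite in_itv /= => rst; apply: cf; exact: I_itv rst.
Qed.

Lemma derive0_constant (f : R -> R) :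
  (forall s, I s -> is_derive s 1 f 0) -> forall s t, I s -> I t -> f s = f t.
Proof.
move=> df; suff H s t : I s -> I t -> s <= t -> f s = f t.
  by move=> s t Is It; case/orP: (le_total s t) => st; [exact: H|exact/esym/H].
move=> Is It st.
have dfi r : r \in `]s, t[%R -> is_derive r 1 f ((fun=> 0) r).
  rewrite in_itv /= => /andP[sr rt]; apply: df.
  by apply: (I_itv Is It); rewrite (ltW sr) (ltW rt).
have cf : {within `[s, t], continuous f}.
  by apply: segment_within => // r /df; exact: is_derive_continuous.
have [r _ /eqP] := MVT_segment st dfi cf.
by rewrite mul0r subr_eq0 => /eqP.
Qed.

(** Intermediate value theorem; stated as a product so that no sign has to be
    chosen. *)
Lemma nonvanishing_sign (g : R -> R) :
  (forall s, I s -> {for s, continuous g}) -> (forall s, I s -> g s != 0) ->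
  forall s t, I s -> I t -> 0 < g s * g t.
Proof.
move=> cg g0; suff H s t : I s -> I t -> s <= t -> 0 < g s * g t.
  by move=> s t Is It; case/orP: (le_total s t) => st; [exact: H|rewrite mulrC H].
move=> Is It st; rewrite ltNge; apply/negP => gst.
have /(IVT st) : {within `[s, t], continuous g} by exact: segment_within.
move=> /(_ 0); case.
  have gs := g0 _ Is; have gt := g0 _ It.
  by rewrite ge_min le_max; nra.
move=> r; rewrite in_itv /= => rst gr.
by move: (g0 _ (I_itv Is It rst)); rewrite gr eqxx.
Qed.

End Intervals.

(** * The Lorentz form and the cross product of R^(2,1) *)

Section Lorentz.
Variables (R : realType).

Lemma dotC d (u v : 'rV[R]_d) : dot u v = dot v u.
Proof. by apply: eq_bigr => i _; rewrite mulrC. Qed.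

Lemma dotDl d (u v w : 'rV[R]_d) : dot (u + v) w = dot u w + dot v w.
Proof. by rewrite -big_split; apply: eq_bigr => i _; rewrite mxE mulrDl. Qed.

Lemma dotZl d a (u w : 'rV[R]_d) : dot (a *: u) w = a * dot u w.
Proof. by rewrite mulr_sumr; apply: eq_bigr => i _; rewrite mxE mulrA. Qed.

Lemma dotDr d (u v w : 'rV[R]_d) : dot w (u + v) = dot w u + dot w v.
Proof. by rewrite dotC dotDl !(dotC w). Qed.

Lemma dotZr d a (u w : 'rV[R]_d) : dot w (a *: u) = a * dot w u.
Proof. by rewrite dotC dotZl dotC. Qed.

Lemma dot0l d (w : 'rV[R]_d) : dot 0 w = 0.
Proof. by rewrite -(scale0r 0) dotZl mul0r. Qed.

Lemma dot_ge0 d (u : 'rV[R]_d) : 0 <= dot u u.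
Proof. by apply: sumr_ge0 => i _; rewrite -expr2 sqr_ge0. Qed.

Lemma dot_eq0 d (u : 'rV[R]_d) : dot u u = 0 -> u = 0.
Proof.
move=> /eqP; rewrite psumr_eq0 => [/allP u0|i _]; last by rewrite -expr2 sqr_ge0.
apply/rowP => i; rewrite mxE; apply/eqP.
by move: (u0 i (mem_index_enum _)); rewrite /= -expr2 sqrf_eq0.
Qed.

Lemma lorentzC d (u v : 'rV[R]_(d + 1)) : lorentz u v = lorentz v u.
Proof. by rewrite /lorentz dotC [X in _ - X]dotC. Qed.

Lemma lorentzDl d (u v w : 'rV[R]_(d + 1)) :
  lorentz (u + v) w = lorentz u w + lorentz v w.
Proof. by rewrite /lorentz !linearD !dotDl; ring. Qed.

Lemma lorentzZl d a (u w : 'rV[R]_(d + 1)) :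
  lorentz (a *: u) w = a * lorentz u w.
Proof. by rewrite /lorentz !linearZ !dotZl; ring. Qed.

Lemma lorentzDr d (u v w : 'rV[R]_(d + 1)) :
  lorentz w (u + v) = lorentz w u + lorentz w v.
Proof. by rewrite lorentzC lorentzDl !(lorentzC w). Qed.

Lemma lorentzZr d a (u w : 'rV[R]_(d + 1)) :
  lorentz w (a *: u) = a * lorentz w u.
Proof. by rewrite lorentzC lorentzZl lorentzC. Qed.

Lemma lorentz0l d (w : 'rV[R]_(d + 1)) : lorentz 0 w = 0.
Proof. by rewrite -(scale0r 0) lorentzZl mul0r. Qed.

Lemma lorentz0r d (w : 'rV[R]_(d + 1)) : lorentz w 0 = 0.
Proof. by rewrite lorentzC lorentz0l. Qed.

Lemma lorentz_suml d n (F : 'I_n -> 'rV[R]_(d + 1)) w :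
  lorentz (\sum_i F i) w = \sum_i lorentz (F i) w.
Proof.
by elim/big_rec2: _ => [|i y1 y2 _ <-]; rewrite ?lorentz0l ?lorentzDl.
Qed.

(** The indices of the coordinates x_1, x_(2n+1) and z. *)
Definition i0 : 'I_(2 + 1) := inord 0.
Definition i1 : 'I_(2 + 1) := inord 1.
Definition i2 : 'I_(2 + 1) := inord 2.

Lemma ord3P (P : 'I_(2 + 1) -> Prop) : P i0 -> P i1 -> P i2 -> forall i, P i.
Proof.
move=> p0 p1 p2 [[|[|[|k]]] //= Hk].
- by rewrite (_ : Ordinal Hk = i0) //; apply/val_inj; rewrite /= inordK.
- by rewrite (_ : Ordinal Hk = i1) //; apply/val_inj; rewrite /= inordK.
- by rewrite (_ : Ordinal Hk = i2) //; apply/val_inj; rewrite /= inordK.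
Qed.

Definition vec3 (a b c : R) : 'rV[R]_(2 + 1) :=
  \row_i (if i == i0 then a else if i == i1 then b else c).

Lemma vec3E a b c : (vec3 a b c 0 i0 = a) * (vec3 a b c 0 i1 = b) *
  (vec3 a b c 0 i2 = c).
Proof.
by do !split; rewrite mxE -!val_eqE /= !inordK.
Qed.

Lemma row3P (u v : 'rV[R]_(2 + 1)) : u 0 i0 = v 0 i0 -> u 0 i1 = v 0 i1 ->
  u 0 i2 = v 0 i2 -> u = v.
Proof. by move=> h0 h1 h2; apply/rowP; apply: ord3P. Qed.

Lemma sum3E (F : 'I_(2 + 1) -> R) : \sum_i F i = F i0 + F i1 + F i2.
Proof.
rewrite !big_ord_recl big_ord0 addr0 addrA; congr (F _ + F _ + F _);
  by apply/val_inj; rewrite /= ?inordK.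
Qed.

Lemma lorentz3E (u v : 'rV[R]_(2 + 1)) :
  lorentz u v = u 0 i0 * v 0 i0 + u 0 i1 * v 0 i1 - u 0 i2 * v 0 i2.
Proof.
rewrite /lorentz /dot !big_ord_recl !big_ord0 !mxE !addr0.
by congr (u 0 _ * v 0 _ + u 0 _ * v 0 _ - u 0 _ * v 0 _);
  apply/val_inj; rewrite /= ?inordK.
Qed.

(** Characterized by lorentz (cross u v) w = det (u, v, w). *)
Definition cross (u v : 'rV[R]_(2 + 1)) : 'rV[R]_(2 + 1) :=
  vec3 (u 0 i1 * v 0 i2 - u 0 i2 * v 0 i1)
       (u 0 i2 * v 0 i0 - u 0 i0 * v 0 i2)
       (u 0 i1 * v 0 i0 - u 0 i0 * v 0 i1).

Lemma lorentz_cross u v :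
  (lorentz (cross u v) u = 0) * (lorentz (cross u v) v = 0).
Proof. by split; rewrite lorentz3E !vec3E; ring. Qed.

Lemma cross_gram u v u' v' : lorentz (cross u v) (cross u' v') =
  lorentz u v' * lorentz v u' - lorentz u u' * lorentz v v'.
Proof. by rewrite !lorentz3E !vec3E; ring. Qed.

Lemma cross_cross u v w :
  cross w (cross u v) = lorentz w u *: v - lorentz w v *: u.
Proof. by apply: row3P; rewrite !lorentz3E /cross !vec3E ?mxE; ring. Qed.

Lemma crossDr u v w : cross u (v + w) = cross u v + cross u w.
Proof. by apply: row3P; rewrite [RHS]mxE /cross !vec3E ?mxE; ring. Qed.

Lemma crossZr u a w : cross u (a *: w) = a *: cross u w.
Proof. by apply: row3P; rewrite [RHS]mxE /cross !vec3E ?mxE; ring. Qed.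

Lemma cross_self u : cross u u = 0.
Proof. by apply: row3P; rewrite /cross !vec3E ?mxE; ring. Qed.

Lemma crossC u v : cross u v = - cross v u.
Proof. by apply: row3P; rewrite [RHS]mxE /cross !vec3E ?mxE; ring. Qed.

Section Frame.
Variables g t : 'rV[R]_(2 + 1).
Hypotheses (hg : lorentz g g = -1) (ht : lorentz t t = 1)
  (hgt : lorentz g t = 0).
Let N := cross g t.

Lemma frame_normal : lorentz N N = 1.
Proof. by rewrite cross_gram hg ht [lorentz t g]lorentzC hgt; ring. Qed.

(** Evaluates the triple product cross N (cross w N) in two ways, with
    cross w N = cross w (cross g t) expanded first: since cross N t = g and
    cross N g = t, it is both a combination of g and t and the difference of w
    and its component along N. *)
Lemma frame_decomp w :
  w = lorentz w t *: t + lorentz w N *: N - lorentz w g *: g.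
Proof.
have E := cross_cross w N N; rewrite frame_normal in E.
rewrite [cross w N]cross_cross -[in X in cross _ X]scaleNr crossDr !crossZr in E.
have Nt : cross N t = g.
  by rewrite crossC cross_cross ht [lorentz t g]lorentzC hgt scale0r sub0r opprK scale1r.
have Ng : cross N g = t.
  by rewrite crossC cross_cross hg hgt scale0r subr0 scaleN1r opprK.
rewrite Nt Ng scale1r (lorentzC N w) in E.
move: (N) E {Nt Ng} => M /rowP E; apply/rowP => i; move/(_ i): E.
by rewrite !mxE; lra.
Qed.

Lemma frame_lorentz w1 w2 :
  lorentz w1 w2 = lorentz w1 t * lorentz w2 t + lorentz w1 N * lorentz w2 N
                - lorentz w1 g * lorentz w2 g.
Proof.
rewrite {1}(frame_decomp w1) !lorentzDl -scaleNr !lorentzZl.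
by rewrite !(lorentzC w2); ring.
Qed.
End Frame.

End Lorentz.

(** * Unit speed curves of the hyperbolic plane *)

Section Curve.
Variables (R : realType) (I : set R) (gamma : R -> 'rV[R]_(2 + 1)).
Hypotheses (I_open : open I) (gamma_curve : arc_length_curve I gamma).

Definition jet k s : 'rV[R]_(2 + 1) := derive1n k gamma s.
Definition normal s := cross (jet 0 s) (jet 1 s).
Definition det3 a b c s := lorentz (jet c s) (cross (jet a s) (jet b s)).
(** The signed curvature: unlike its absolute value, which is the curvature, it
    is smooth also where it vanishes. *)
Definition scurv s := det3 0 1 2 s.

Lemma is_derive_jet k s : I s -> is_derive s 1 (jet k) (jet k.+1 s).
Proof.
move=> Is; have [d _ _] := gamma_curve Is; split; first exact: d.
by rewrite /jet derive1nS derive1E.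
Qed.

Lemma is_derive_lorentz (f g : R -> 'rV[R]_(2 + 1)) (s : R) df dg :
  is_derive s 1 f df -> is_derive s 1 g dg ->
  is_derive s 1 (fun r => lorentz (f r) (g r)) (lorentz df (g s) + lorentz (f s) dg).
Proof.
move=> hf hg.
have -> : (fun r => lorentz (f r) (g r)) = (fun r => f r 0 i0 * g r 0 i0 +
    f r 0 i1 * g r 0 i1 - f r 0 i2 * g r 0 i2).
  by apply/funext => r; rewrite lorentz3E.
have H i := is_derive_ptM (is_derive_coord 0 i hf) (is_derive_coord 0 i hg).
have := is_derive_ptB (is_derive_ptD (H i0) (H i1)) (H i2).
by congr (is_derive _ _ _ _); rewrite !lorentz3E; ring.
Qed.

Lemma is_derive_cross (f g : R -> 'rV[R]_(2 + 1)) (s : R) df dg :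
  is_derive s 1 f df -> is_derive s 1 g dg ->
  is_derive s 1 (fun r => cross (f r) (g r)) (cross df (g s) + cross (f s) dg).
Proof.
move=> hf hg.
have H i j := is_derive_ptM (is_derive_coord 0 i hf) (is_derive_coord 0 j hg).
have K i j i' j' := is_derive_ptB (H i j) (H i' j').
apply: is_derive_mx => i j; rewrite (ord1 i) => {i}.
elim/ord3P: j; rewrite [X in is_derive _ _ _ X]mxE /cross !vec3E.
- have := K i1 i2 i2 i1; congr (is_derive _ _ _ _).
    by apply/funext => r; rewrite !vec3E.
  ring.
- have := K i2 i0 i0 i2; congr (is_derive _ _ _ _).
    by apply/funext => r; rewrite !vec3E.
  ring.
- have := K i1 i0 i0 i1; congr (is_derive _ _ _ _).
    by apply/funext => r; rewrite !vec3E.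
  ring.
Qed.

Lemma jet00 s : I s -> lorentz (jet 0 s) (jet 0 s) = -1.
Proof. by move=> Is; have [_ [h _] _] := gamma_curve Is. Qed.

Lemma jet11 s : I s -> lorentz (jet 1 s) (jet 1 s) = 1.
Proof. by move=> Is; have [_ _] := gamma_curve Is. Qed.

Lemma jet01 s : I s -> lorentz (jet 0 s) (jet 1 s) = 0.
Proof.
move=> Is; have := is_derive_lorentz (is_derive_jet 0 Is) (is_derive_jet 0 Is).
move=> /(is_derive_local_cst I_open Is jet00).
by rewrite [lorentz (jet 1 s) _]lorentzC; lra.
Qed.

Lemma jet02 s : I s -> lorentz (jet 0 s) (jet 2 s) = -1.
Proof.
move=> Is; have := is_derive_lorentz (is_derive_jet 0 Is) (is_derive_jet 1 Is).
move=> /(is_derive_local_cst I_open Is jet01).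
by rewrite jet11 //; lra.
Qed.

Lemma jet12 s : I s -> lorentz (jet 1 s) (jet 2 s) = 0.
Proof.
move=> Is; have := is_derive_lorentz (is_derive_jet 1 Is) (is_derive_jet 1 Is).
move=> /(is_derive_local_cst I_open Is jet11).
by rewrite [lorentz (jet 2 s) _]lorentzC; lra.
Qed.

Lemma normal_unit s : I s -> lorentz (normal s) (normal s) = 1.
Proof. by move=> Is; rewrite frame_normal ?jet00 ?jet11 ?jet01. Qed.

(** The position vector is the normal of the hyperboloid, so the component of
    gamma'' along it is forced by the unit speed; the rest is normal to the curve
    in H^2. *)
Lemma frenet_tangent s : I s -> jet 2 s = jet 0 s + scurv s *: normal s.
Proof.
move=> Is; rewrite {1}(frame_decomp (jet00 Is) (jet11 Is) (jet01 Is) (jet 2 s)).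
by rewrite (lorentzC (jet 2 s) (jet 1 s)) jet12 // (lorentzC (jet 2 s) (jet 0 s))
  jet02 // scale0r add0r scaleN1r opprK addrC.
Qed.

Lemma frenet_normal s : I s -> is_derive s 1 normal (- scurv s *: jet 1 s).
Proof.
move=> Is; have := is_derive_cross (is_derive_jet 0 Is) (is_derive_jet 1 Is).
rewrite cross_self add0r frenet_tangent // crossDr cross_self add0r crossZr.
by rewrite /normal cross_cross jet00 // jet01 // scale0r subr0 scaleN1r scalerN scaleNr.
Qed.

Lemma curvatureE s : I s -> curvature gamma s = `|scurv s|.
Proof.
move=> Is; rewrite /curvature.
have -> : acceleration gamma s = scurv s *: normal s.
  rewrite /acceleration -[derive1n 2 gamma s]/(jet 2 s) -[gamma s]/(jet 0 s).
  by rewrite (lorentzC (jet 2 s) (jet 0 s)) jet02 // frenet_tangent // scaleN1r addrC addKr.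
by rewrite lorentzZl lorentzZr normal_unit // mulr1 -expr2 sqrtr_sqr.
Qed.

Lemma curvature_sqr s : I s -> curvature gamma s ^+ 2 = scurv s ^+ 2.
Proof. by move=> Is; rewrite curvatureE // real_normK ?num_real. Qed.

Definition scurv1 s := det3 0 1 3 s.
Definition scurv2 s := det3 0 2 3 s + det3 0 1 4 s.

Lemma is_derive_det3 a b c s : I s -> is_derive s 1 (det3 a b c)
  (det3 a.+1 b c s + det3 a b.+1 c s + det3 a b c.+1 s).
Proof.
move=> Is; have := is_derive_lorentz (is_derive_jet c Is)
  (is_derive_cross (is_derive_jet a Is) (is_derive_jet b Is)).
by congr (is_derive _ _ _ _); rewrite lorentzDr /det3; ring.
Qed.

Lemma det3_ll a c s : det3 a a c s = 0.
Proof. by rewrite /det3 cross_self lorentz0r. Qed.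

Lemma det3_rr a b s : det3 a b b s = 0.
Proof. by rewrite /det3 lorentzC lorentz_cross. Qed.

(** The two determinants with a repeated entry drop out of the derivative of
    det (gamma, gamma', gamma''). *)
Lemma is_derive_scurv s : I s -> is_derive s 1 scurv (scurv1 s).
Proof.
move=> Is; have := is_derive_det3 0 1 2 Is; congr (is_derive _ _ _ _).
by rewrite (det3_ll 1) (det3_rr 0 2) !add0r.
Qed.

Lemma is_derive_scurv1 s : I s -> is_derive s 1 scurv1 (scurv2 s).
Proof.
move=> Is; have := is_derive_det3 0 1 3 Is; congr (is_derive _ _ _ _).
by rewrite (det3_ll 1) add0r.
Qed.

Lemma scurv2_continuous s : I s -> {for s, continuous scurv2}.
Proof.
move=> Is; have := is_derive_ptD (is_derive_det3 0 2 3 Is) (is_derive_det3 0 1 4 Is).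
exact: is_derive_continuous.
Qed.

End Curve.

(** * From the first-order equation to a second-order one *)

Section ScalarODE.
Variables (R : realType) (I : set R).
Hypotheses (I_open : open I) (I_itv : is_interval I).

(** The square makes real powers of the absolute value of k differentiable
    without a choice of sign for k. *)
Lemma is_derive_powR_sqr (k : R -> R) p s k1 : k s != 0 -> is_derive s 1 k k1 ->
  is_derive s 1 (fun r => (k r ^+ 2) `^ p) (2 * p * (k s ^+ 2) `^ p * k1 / k s).
Proof.
move=> k0 dk; have k2 : 0 < k s ^+ 2 by rewrite exprn_even_gt0.
have := is_derive_chain (f := fun r => k r * k r)
  (is_derive1_powR p k2) (is_derive_ptM dk dk).
congr (is_derive _ _ _ _).
rewrite powRB ?(gt_eqF k2) ?implybT // powRr1 ?(ltW k2) //.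
by field.
Qed.

Lemma second_derivative_continuous (c : R) (f f1 k k1 k2 : R -> R) s :
  k s != 0 -> c != 0 ->
  {for s, continuous f} -> {for s, continuous f1} -> {for s, continuous k} ->
  {for s, continuous k1} -> {for s, continuous k2} ->
  {for s, continuous (fun r => - ((f1 r * k1 r + f r * k2 r) * k r
     - f r * k1 r * k1 r) / (2 * c * k r ^+ 2))}.
Proof.
move=> k0 c0 cf cf1 ck ck1 ck2.
have ckk : {for s, continuous (fun r => (2 * c * (k r * k r))^-1)}.
  apply: continuousV; first by rewrite !mulf_neq0 ?pnatr_eq0.
  apply: (@continuousM _ _ (fun=> 2 * c) (fun r => k r * k r)).
    exact: cst_continuous.
  exact: (@continuousM _ _ k k).
apply: continuousM ckk; apply: continuousN; apply: continuousB.
  exact: continuousM (continuousD (continuousM cf1 ck1) (continuousM cf ck2)) ck.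
exact: continuousM (continuousM cf ck1) ck1.
Qed.

(** Differentiating the first integral gives f1 * phi = 0, where
    phi = f2 - psi and psi = f + k^2 f / m > 0, so phi vanishes wherever f1 does
    not. The issue is a zero set of f1 with interior, where a solution could rest
    at an equilibrium before leaving it. There f2 = 0, that is phi = - psi; hence
    phi only takes the values 0 and - psi, and phi + psi / 2 is a continuous
    function without zeros. Its sign is constant on the interval, and it is
    positive at a point where f1 does not vanish. *)
Lemma first_integral_second_order (m : R) (f f1 f2 k k1 : R -> R) : 0 < m ->
  (forall s, I s -> [/\ is_derive s 1 f (f1 s), is_derive s 1 f1 (f2 s),
     is_derive s 1 k (k1 s) & {for s, continuous f2}]) ->
  (forall s, I s -> 0 < f s) ->
  (forall s, I s -> k1 s * f s = - (m + 1) * k s * f1 s) ->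
  (forall s, I s -> f1 s ^+ 2 = 1 + f s ^+ 2 - (k s * f s / m) ^+ 2) ->
  (exists2 s, I s & f1 s != 0) ->
  forall s, I s -> f2 s = f s + k s ^+ 2 * f s / m.
Proof.
move=> m0 df f0 k1E f1E [t0 It0 f1t0].
pose psi s := f s + k s ^+ 2 * f s / m.
have psi0 s : I s -> 0 < psi s.
  move=> Is; apply: ltr_wpDr; last exact: f0.
  by rewrite divr_ge0 ?(ltW m0) // mulr_ge0 ?sqr_ge0 // ltW // f0.
have dpsi s : I s -> exists d, is_derive s 1 psi d.
  move=> Is; have [d1 _ d3 _] := df _ Is; eexists.
  exact: (is_derive_ptD d1 (is_derive_ptM (is_derive_ptM (is_derive_ptM d3 d3) d1)
    (is_derive_cst m^-1 s 1))).
pose phi s := f2 s - psi s.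
have cphi s : I s -> {for s, continuous phi}.
  move=> Is; have [_ _ _ c] := df _ Is; have [d dp] := dpsi _ Is.
  by apply: continuousB => //; exact: is_derive_continuous dp.
have f1phi s : I s -> f1 s * phi s = 0.
  move=> Is; have [d1 d2 d3 _] := df _ Is.
  have dg := is_derive_ptB (is_derive_ptD (is_derive_cst (1 : R) s 1)
    (is_derive_ptM d1 d1)) (is_derive_ptM (is_derive_ptM (is_derive_ptM d3 d1)
    (is_derive_cst m^-1 s 1)) (is_derive_ptM (is_derive_ptM d3 d1)
    (is_derive_cst m^-1 s 1))).
  have df1 := is_derive_ptM d2 d2.
  have := is_derive_local I_open Is (fun r Ir => esym (f1E r Ir)) dg.
  move=> /is_derive_unique/(_ df1).
  have mn0 : m != 0 by rewrite gt_eqF.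
  have -> : (k1 s * f s + k s * f1 s) / m + k s * f s * 0 = - k s * f1 s.
    by rewrite k1E //; field.
  rewrite /phi /psi /cst => E; apply: (@mulfI _ 2); first by rewrite pnatr_eq0.
  by move: E; lra.
have phi_zero s : I s -> phi s * f2 s = 0.
  move=> Is; have [->|phis] := eqVneq (phi s) 0; first by rewrite mul0r.
  have [U [oU Us Uphi]] : exists U : set R, [/\ open U, U s & U `<=` [set r | phi r != 0]].
    exists (interior [set r | phi r != 0]); split; [exact: open_interior| |exact: interior_subset].
    have := cphi _ Is; rewrite /continuous_at => /(_ [set y | y != 0]); apply.
    by apply: open_nbhs_nbhs; split => //; exact: open_neq.
  have [_ d2 _ _] := df _ Is.
  have -> : f2 s = 0; last by rewrite mulr0.
  apply: (@is_derive_local_cst _ _ _ (U `&` I) f1 0 s 1) => //.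
  - exact: openI.
  - move=> r [/Uphi /= ph Ir]; have /eqP := f1phi _ Ir.
    by rewrite mulf_eq0 (negPf ph) orbF => /eqP.
(* g = psi / 2 where phi = 0, and g = - psi / 2 elsewhere *)
pose g s := phi s + psi s / 2.
have cg s : I s -> {for s, continuous g}.
  move=> Is; have [d dp] := dpsi _ Is.
  have := is_derive_ptM dp (is_derive_cst (2^-1 : R) s 1).
  by move=> /is_derive_continuous; exact: continuousD (cphi _ Is).
have g0 s : I s -> g s != 0.
  move=> Is; have p0 := psi0 _ Is; have := phi_zero _ Is.
  rewrite /g /phi; apply: contra_eqN => /eqP E.
  have -> : f2 s = psi s / 2 by lra.
  by rewrite (_ : _ - _ = - (psi s / 2)) ?mulNr ?oppr_eq0 ?mulf_neq0 ?gt_eqF ?divr_gt0 //; field.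
have gt0 : 0 < g t0.
  rewrite /g; have /eqP := f1phi _ It0; rewrite mulf_eq0 (negPf f1t0) => /eqP ->.
  by rewrite add0r divr_gt0 ?psi0.
move=> s Is; have gs : 0 < g s.
  by rewrite -(pmulr_rgt0 _ gt0) mulrC; apply: (nonvanishing_sign I_itv cg g0).
have /eqP := phi_zero _ Is; rewrite mulf_eq0 => /orP[|/eqP f20].
  by rewrite subr_eq0 => /eqP.
have := psi0 _ Is; move: gs; rewrite /g /phi f20; lra.
Qed.

End ScalarODE.

Section Warping.
Variables (R : realType) (n : nat) (a : R) (gamma : R -> 'rV[R]_(2 + 1)).
Hypotheses (n_gt0 : (0 < n)%N) (a_gt0 : 0 < a).
Let m : R := 2 * n%:R - 1.

Lemma m_gt0 : 0 < m.
Proof.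
by have : (1 : R) <= n%:R; [rewrite ler1n | rewrite /m; lra].
Qed.

Lemma u_of_gt0 s : 0 < curvature gamma s -> 0 < u_of n gamma s.
Proof. by move=> k0; rewrite powR_gt0. Qed.

Lemma u_of_expn s : 0 <= curvature gamma s -> u_of n gamma s ^+ n = curvature gamma s.
Proof.
move=> k0; rewrite -powR_mulrn ?powR_ge0 // -powRrM mulVf ?powRr1 //.
by rewrite pnatr_eq0 -lt0n.
Qed.

Lemma warping_u s : warping n a gamma s =
  m / (2 * n%:R * Num.sqrt a * Num.sqrt (u_of n gamma s)).
Proof.
rewrite /warping /u_of -[Num.sqrt (_ `^ _)]powR12_sqrt ?powR_ge0 // -powRrM.
by rewrite -[n%:R^-1 * _]invfM [n%:R * 2]mulrC.
Qed.

Lemma warping_gt0 s : 0 < curvature gamma s -> 0 < warping n a gamma s.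
Proof.
move=> /u_of_gt0 u0; rewrite warping_u divr_gt0 ?m_gt0 //.
by rewrite !mulr_gt0 ?sqrtr_gt0 // ltr0n.
Qed.

(** The warping function is, up to a constant, the inverse square root of u.
    This form avoids all roots. *)
Lemma warping_sqr s : 0 < curvature gamma s ->
  4 * n%:R ^+ 2 * a * u_of n gamma s * warping n a gamma s ^+ 2 = m ^+ 2.
Proof.
move=> /u_of_gt0 u0; rewrite warping_u expr_div_n !exprMn !sqr_sqrtr ?(ltW a_gt0) ?(ltW u0) //.
have n0 : (n%:R : R) != 0 by rewrite pnatr_eq0 -lt0n.
have := gt_eqF a_gt0; have := gt_eqF u0.
by move=> /negbT h1 /negbT h2; field; rewrite h1 h2 n0.
Qed.

End Warping.

Section EulerLagrange.
Variables (R : realType) (n : nat) (I : set R) (gamma : R -> 'rV[R]_(2 + 1)).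
Hypotheses (n_gt0 : (0 < n)%N) (I_open : open I) (I_itv : is_interval I)
  (gamma_curve : arc_length_curve I gamma).
Let m : R := 2 * n%:R - 1.
Let k := scurv gamma.
Let k1 := scurv1 gamma.
Let k2 := scurv2 gamma.
Let dk := is_derive_scurv gamma_curve.
Let dk1 := is_derive_scurv1 gamma_curve.
Let n0 : (n%:R : R) != 0. Proof. by rewrite pnatr_eq0 -lt0n. Qed.
Let m0 : 0 < m. Proof. exact: m_gt0. Qed.

Lemma curvature_powR p s : I s ->
  curvature gamma s `^ p = (k s ^+ 2) `^ (p / 2).
Proof.
move=> Is; rewrite (curvatureE I_open gamma_curve) // -sqrtr_sqr.
by rewrite -powR12_sqrt ?sqr_ge0 // -powRrM mulrC.
Qed.

Lemma is_derive_curvature_powR p s : I s -> 0 < curvature gamma s ->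
  is_derive s 1 (fun r => curvature gamma r `^ p)
    (p * curvature gamma s `^ p * k1 s / k s).
Proof.
move=> Is ks0; have k0 : k s != 0.
  by move: ks0; rewrite (curvatureE I_open gamma_curve) // normr_gt0.
rewrite curvature_powR //.
have := is_derive_powR_sqr (p / 2) k0 (dk Is).
have -> : 2 * (p / 2) = p by field.
by apply: is_derive_local I_open Is _ => r Ir; rewrite curvature_powR.
Qed.

Section Solution.
Variable a : R.
Hypotheses (a_gt0 : 0 < a) (EL : euler_lagrange n a I gamma).
Let f := warping n a gamma.

Let kappa0 s : I s -> 0 < curvature gamma s.
Proof. by case: EL => h _ _; exact: h. Qed.

Let k0 s : I s -> k s != 0.
Proof. by move=> Is; move: (kappa0 Is); rewrite (curvatureE I_open gamma_curve) // normr_gt0. Qed.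

Definition warping1 s := - (f s * k1 s) / (2 * n%:R * k s).
Definition warping2 s := - ((warping1 s * k1 s + f s * k2 s) * k s
  - f s * k1 s * k1 s) / (2 * n%:R * k s ^+ 2).

Lemma is_derive_warping s : I s -> is_derive s 1 f (warping1 s).
Proof.
move=> Is; pose C := m / (2 * n%:R * Num.sqrt a).
have fE r : f r = C * curvature gamma r `^ (- (2 * n%:R)^-1).
  by rewrite /f /warping -/m powRN /C invfM; ring.
have -> : f = fun r => C * curvature gamma r `^ (- (2 * n%:R)^-1).
  by apply/funext => r.
have := is_derive_ptM (is_derive_cst C s 1)
  (is_derive_curvature_powR (- (2 * n%:R)^-1) Is (kappa0 Is)).
congr (is_derive _ _ _ _); rewrite /warping1 fE /cst mul0r add0r.
by field; rewrite k0.
Qed.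

Lemma is_derive_warping1 s : I s -> is_derive s 1 warping1 (warping2 s).
Proof.
move=> Is; have kn0 : 2 * n%:R * k s != 0 by rewrite !mulf_neq0 ?k0 ?pnatr_eq0 -?lt0n.
have D := is_derive_ptV (f := fun r => cst (2 * n%:R : R) r * k r) kn0 (is_derive_ptM (is_derive_cst (2 * n%:R : R) s 1) (dk Is)).
have := is_derive_ptM (is_derive_ptB (is_derive_cst (0 : R) s 1)
  (is_derive_ptM (is_derive_warping Is) (dk1 Is))) D.
congr (is_derive _ _ _ _).
  by apply/funext => r; rewrite /warping1 /cst sub0r.
rewrite /warping2 /cst !(sub0r, mul0r, add0r) -/k -/k1 -/k2 -/f. by field; rewrite k0 ?n0.
Qed.

Lemma warping2_continuous s : I s -> {for s, continuous warping2}.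
Proof.
move=> Is.
have ck := is_derive_continuous (dk Is).
have ck1 := is_derive_continuous (dk1 Is).
have ck2 := scurv2_continuous gamma_curve Is.
have cf := is_derive_continuous (is_derive_warping Is).
have cf1 := is_derive_continuous (is_derive_warping1 Is).
exact: (second_derivative_continuous (k0 Is) n0 cf cf1 ck ck1 ck2).
Qed.

(** The logarithmic derivative of a power of the curvature of exponent
    - 1 / (2 n); recall that m + 1 = 2 n. *)
Lemma warping_curvature s : I s -> k1 s * f s = - (m + 1) * k s * warping1 s.
Proof. by move=> Is; rewrite /warping1 /m; field; rewrite k0 ?n0. Qed.

(** The Euler-Lagrange equation rewritten in terms of the warping function f:
    since f is proportional to u^(-1/2), u' / u = - 2 f' / f, and the term linear
    in u becomes the constant 1. Geometrically, this equation says that a vector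
    with components f', k f / m and - f in the moving frame is a unit vector. *)
Lemma warping_first_integral s : I s ->
  warping1 s ^+ 2 = 1 + f s ^+ 2 - (k s * f s / m) ^+ 2.
Proof.
move=> Is; have [_ _ /(_ _ Is)[_]] := EL.
set u := u_of n gamma s => E.
have u0 : 0 < u by rewrite u_of_gt0 // kappa0.
have uk : u ^+ (2 * n) = k s ^+ 2.
  by rewrite mulnC exprM u_of_expn ?(ltW (kappa0 Is)) // (curvatureE I_open gamma_curve) // real_normK ?num_real.
have du : derive1 (u_of n gamma) s = n%:R^-1 * u * k1 s / k s.
  by rewrite derive1E; case: (is_derive_curvature_powR n%:R^-1 Is (kappa0 Is)).
rewrite du uk -/m in E.
have fu := warping_sqr n_gt0 a_gt0 (kappa0 Is); rewrite -/u -/f -/m in fu.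
have mn0 : m != 0 by rewrite gt_eqF.
have kn0 := k0 Is.
have E2 : (k1 s / (n%:R * k s)) ^+ 2 * m ^+ 2 = 4 * (- k s ^+ 2 + 4 * n%:R ^+ 2 * a * u + m ^+ 2).
  apply: (@mulfI _ (u ^+ 2 / m ^+ 2)); first by rewrite mulf_neq0 ?invr_neq0 ?expf_neq0 ?gt_eqF.
  transitivity ((n%:R^-1 * u * k1 s / k s) ^+ 2); first by field; rewrite kn0 n0.
  by rewrite E; field.
have -> : warping1 s ^+ 2 = f s ^+ 2 * ((k1 s / (n%:R * k s)) ^+ 2 * m ^+ 2) / (4 * m ^+ 2).
  by rewrite /warping1; field; rewrite kn0 mn0 n0.
rewrite E2; apply: (@mulfI _ (m ^+ 2)); first by rewrite expf_neq0.
transitivity (- (f s * k s) ^+ 2 + f s ^+ 2 * m ^+ 2 + 4 * n%:R ^+ 2 * a * u * f s ^+ 2).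
  by field.
by rewrite fu; field.
Qed.

Lemma warping_second_order s : I s ->
  warping2 s = f s + k s ^+ 2 * f s / m.
Proof.
apply: (@first_integral_second_order _ _ I_open I_itv m f warping1 warping2 k k1 m0).
- by move=> r Ir; split; [exact: is_derive_warping|exact: is_derive_warping1|exact: dk|exact: warping2_continuous].
- by move=> r Ir; apply: warping_gt0 => //; exact: kappa0.
- exact: warping_curvature.
- exact: warping_first_integral.
- apply: contrapT => H.
  have [_ [r [t [Ir It /negP Hrt]]] _] := EL; apply: Hrt; apply/eqP.
  have f_cst : forall r, I r -> is_derive r 1 f 0.
    move=> q Iq; have -> : 0 = warping1 q; last exact: is_derive_warping.
    by apply/esym/eqP; apply: contrapT => /negP h; apply: H; exists q.
  have frt := derive0_constant I_itv f_cst Ir It.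
  have u_rt : u_of n gamma r = u_of n gamma t.
    have h1 := warping_sqr n_gt0 a_gt0 (kappa0 Ir).
    have h2 := warping_sqr n_gt0 a_gt0 (kappa0 It).
    have /lt0r_neq0 wt := warping_gt0 n_gt0 a_gt0 (kappa0 It).
    have c0 : 4 * n%:R ^+ 2 * a != 0.
      by apply: mulf_neq0 (mulf_neq0 _ (expf_neq0 2 n0)) (lt0r_neq0 a_gt0); rewrite pnatr_eq0.
    rewrite -h2 -[warping n a gamma r]/(f r) frt in h1.
    by have := mulIf (expf_neq0 2 wt) h1 => /(mulfI c0).
  have e1 := u_of_expn n_gt0 (ltW (kappa0 Ir)).
  have e2 := u_of_expn n_gt0 (ltW (kappa0 It)).
  by rewrite -[LHS]e1 -[RHS]e2 u_rt.
Qed.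

End Solution.
End EulerLagrange.

(** * The profile equation and its first integral *)

(** The equation k x = (2 n - 1) N_1 between the curvature k, the first coordinate
    x and the first component N_1 of the normal: the two principal curvatures k
    and - N_1 / x of a rotational hypersurface, with multiplicities 1 and 2 n - 1,
    add up to 0. *)
Definition profile_eq (R : realType) (n : nat) (I : set R)
    (gamma : R -> 'rV[R]_(2 + 1)) : Prop :=
  forall s, I s -> jet gamma 0 s 0 i0 != 0 ->
  scurv gamma s * jet gamma 0 s 0 i0 = (2 * n%:R - 1) * normal gamma s 0 i0.

Section Profile.
Variables (R : realType) (n : nat) (I : set R) (gamma : R -> 'rV[R]_(2 + 1)).
Hypotheses (n_gt0 : (0 < n)%N) (I_open : open I) (I_itv : is_interval I)
  (gamma_curve : arc_length_curve I gamma).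
Let m : R := 2 * n%:R - 1.
Let k := scurv gamma.
Let x s : R := jet gamma 0 s 0 i0.
Let x1 s : R := jet gamma 1 s 0 i0.
Let N0 s : R := normal gamma s 0 i0.
Let m0 : 0 < m. Proof. exact: m_gt0. Qed.
Let n0 : (n%:R : R) != 0. Proof. by rewrite pnatr_eq0 -lt0n. Qed.

Let dx s : I s -> is_derive s 1 x (x1 s).
Proof. by move=> Is; have := is_derive_coord 0 i0 (is_derive_jet gamma_curve 0 Is). Qed.

Let dx1 s : I s -> is_derive s 1 x1 (x s + k s * N0 s).
Proof.
move=> Is; have := is_derive_coord 0 i0 (is_derive_jet gamma_curve 1 Is).
by rewrite (frenet_tangent I_open gamma_curve Is) mxE [X in _ + X]mxE.
Qed.

Let dN0 s : I s -> is_derive s 1 N0 (- k s * x1 s).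
Proof.
by move=> Is; have := is_derive_coord 0 i0 (frenet_normal I_open gamma_curve Is); rewrite mxE.
Qed.

(** The unit spacelike vector along the x_1-axis, expanded in the moving frame,
    has components x', N_1 and - x. *)
Lemma axis_norm s : I s -> x1 s ^+ 2 + N0 s ^+ 2 = 1 + x s ^+ 2.
Proof.
move=> Is; pose e : 'rV[R]_(2 + 1) := vec3 1 0 0.
have E (v : 'rV[R]_(2 + 1)) : lorentz e v = v 0 i0.
  by rewrite lorentz3E !vec3E; ring.
have := frame_lorentz (jet00 gamma_curve Is) (jet11 gamma_curve Is)
  (jet01 I_open gamma_curve Is) e e.
rewrite !E vec3E -/(normal gamma s) -/(x s) -/(x1 s) -/(N0 s); lra.
Qed.

(** The first coordinate of the Frenet equation is x'' = x + k N_1. Dividing by k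
    turns a second-order equation for x alone into the profile equation; in this
    form it does not see the orientation of the normal. *)
Lemma second_order_profile_eq :
  (forall s, I s -> 0 < curvature gamma s) ->
  (forall s, I s -> is_derive s 1 x1 (x s + k s ^+ 2 * x s / m)) ->
  profile_eq n I gamma.
Proof.
move=> kappa0 H s Is _; have kn0 : k s != 0.
  by move: (kappa0 _ Is); rewrite (curvatureE I_open gamma_curve) // normr_gt0.
have E := is_derive_unique (H _ Is) (dx1 Is).
apply: (mulfI kn0); rewrite -/(k s) -/(x s) -/(N0 s) -/m.
transitivity ((x s + k s ^+ 2 * x s / m - x s) * m).
  by field; rewrite gt_eqF.
by rewrite E; ring.
Qed.

Section FirstIntegral.
Hypotheses (profile_gamma : profile_eq n I gamma) (s0 : R) (Is0 : I s0) (x0 : x s0 != 0)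
  (s0_curved : k s0 != 0 \/ N0 s0 != 0).

Let profile s : I s -> x s != 0 -> k s * x s = m * N0 s.
Proof. exact: profile_gamma. Qed.

Let N00 : N0 s0 != 0.
Proof.
case: s0_curved => // k0; apply: contra_neq k0 => N00.
have /eqP := profile Is0 x0.
by rewrite N00 mulr0 mulf_eq0 (negPf x0) orbF => /eqP.
Qed.

(* j + 1 = 2 n - 1 *)
Let j := (2 * n.-1)%N.
Let G s := N0 s * x s ^+ j.+1.
Let b := G s0.
Let jE : (j.+1)%:R = m.
Proof.
rewrite /j /m -natr1 natrM; case: n n_gt0 => // l _; rewrite -natr1 /=; ring.
Qed.

(** N_1 x^(2n-1) is a first integral of the profile equation, by N_1' = - k x'.
    Its square is used because its derivative carries a factor
    x ((2 n - 1) N_1 - k x), which is 0 also where x vanishes. Consequently x has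
    no zeros: the curve never meets the axis. *)
Lemma first_integral_const s : I s -> G s ^+ 2 = b ^+ 2.
Proof.
move=> Is; suff dG r : I r -> is_derive r 1 (fun r => G r * G r) 0.
  by rewrite !expr2; apply: (derive0_constant I_itv dG).
move=> Ir.
have dxj : is_derive r 1 (fun r => x r ^+ j.+1) (m * x r ^+ j * x1 r).
  have := is_deriveX j.+1 (dx Ir); rewrite jE /=; congr (is_derive _ _ _ _).
  by apply/funext => q; rewrite exprfctE.
have dG := is_derive_ptM (dN0 Ir) dxj.
have := is_derive_ptM dG dG; congr (is_derive _ _ _ _).
have E : x r * (m * N0 r - k r * x r) = 0.
  have [->|xr] := eqVneq (x r) 0; first by rewrite mul0r.
  by rewrite profile // subrr mulr0.
transitivity (2 * N0 r * x r ^+ j * x r ^+ j * x1 r * (x r * (m * N0 r - k r * x r))).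
  by rewrite exprS; ring.
by rewrite E mulr0.
Qed.

Let b0 : b != 0. Proof. by rewrite mulf_neq0 // expf_neq0. Qed.

Let xn0 s : I s -> x s != 0.
Proof.
move=> Is; apply/eqP => xs; have /eqP := first_integral_const Is.
by rewrite /G xs expr0n /= mulr0 expr0n /= eq_sym sqrf_eq0 (negPf b0).
Qed.

Let beta := m * `|b|.
Let B := beta `^ n%:R^-1.
Let beta0 : 0 < beta. Proof. by rewrite mulr_gt0 // normr_gt0. Qed.
Let B0 : 0 < B. Proof. by rewrite powR_gt0. Qed.

(** Combines k x = m N_1 with N_1 x^(2n-1) = b: the curvature is a constant
    multiple of x^(-2n). *)
Lemma curvature_profile s : I s -> curvature gamma s = beta / x s ^+ (2 * n).
Proof.
move=> Is; rewrite (curvatureE I_open gamma_curve) // -/k.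
have -> : k s = m * N0 s / x s by rewrite -profile ?xn0 // mulfK // xn0.
have := first_integral_const Is; have xs := xn0 Is.
move/(congr1 Num.sqrt); rewrite !sqrtr_sqr => E.
have e2 : (2 * n = j.+2)%N by rewrite /j; case: n n_gt0 => // l _; rewrite mulnS.
have X : x s ^+ (2 * n) = `|x s| * `|x s ^+ j.+1|.
  rewrite -normrM -exprS -e2 ger0_norm // exprM exprn_ge0 // sqr_ge0 //.
rewrite X /beta -E /G !normrM normfV (gtr0_norm m0).
by field; rewrite !normr_eq0 expf_neq0 ?xs.
Qed.

Lemma u_profile s : I s -> u_of n gamma s = B / x s ^+ 2.
Proof.
move=> Is; rewrite /u_of curvature_profile //.
have x2 : 0 < x s ^+ 2 by rewrite exprn_even_gt0 ?xn0.
rewrite powRM ?invr_ge0 ?(ltW beta0) //; last by rewrite exprM exprn_ge0 ?(ltW x2).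
congr (_ * _); rewrite exprM -exprVn -[_ ^+ n]powR_mulrn ?invr_ge0 ?(ltW x2) //.
by rewrite -powRrM mulfV // powRr1 // invr_ge0 ltW.
Qed.

(** The value of a for which the warping function is the absolute value of x. *)
Definition profile_a := m ^+ 2 / (4 * n%:R ^+ 2 * B).

Lemma profile_a_gt0 : 0 < profile_a.
Proof. by rewrite divr_gt0 ?exprn_gt0 // !mulr_gt0 ?exprn_gt0 // ltr0n. Qed.

Let kappa0 s : I s -> 0 < curvature gamma s.
Proof.
move=> Is; rewrite curvature_profile // divr_gt0 // exprM exprn_gt0 //.
by rewrite exprn_even_gt0 ?xn0.
Qed.

Lemma profile_warping s : I s -> x s ^+ 2 = warping n profile_a gamma s ^+ 2.
Proof.
move=> Is; have := warping_sqr n_gt0 profile_a_gt0 (kappa0 Is).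
rewrite u_profile // /profile_a -/m => E; have xs := xn0 Is.
have mm : m ^+ 2 != 0 by rewrite expf_neq0 ?gt_eqF.
apply: (mulfI mm); rewrite -[in LHS]E; field.
by rewrite xs n0 gt_eqF.
Qed.

(** If the curvature were constant, so would be x; then x'' = 0 and
    x (x + k N_1) = x^2 + m N_1^2 > 0 contradict x'' = x + k N_1. The differential
    equation itself is the identity x'^2 + N_1^2 = 1 + x^2 expressed through
    u = B / x^2. *)
Lemma profile_euler_lagrange : euler_lagrange n profile_a I gamma.
Proof.
split => //.
- apply: contrapT => H.
  have kc s : I s -> curvature gamma s = curvature gamma s0.
    move=> Is; apply: contrapT => /eqP h; apply: H; exists s, s0; split => //.
  have xc s : I s -> x s * x s = x s0 * x s0.
    move=> Is; have h1 := u_profile Is; have h2 := u_profile Is0.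
    rewrite /u_of kc // -/(u_of n gamma s0) h2 in h1.
    rewrite -!expr2; have xs := xn0 Is.
    move: h1 => /(mulfI (lt0r_neq0 B0)) /invr_inj //.
  have x1_0 s : I s -> x1 s = 0.
    move=> Is; have /eqP := is_derive_local_cst I_open Is xc (is_derive_ptM (dx Is) (dx Is)).
    rewrite mulrC -mulr2n mulrn_eq0 /= mulf_eq0 (negPf (xn0 Is)) /=.
    by move/eqP.
  have E := is_derive_local_cst I_open Is0 x1_0 (dx1 Is0).
  have : x s0 ^+ 2 + m * N0 s0 ^+ 2 = 0.
    transitivity (x s0 * (x s0 + k s0 * N0 s0)); last by rewrite E mulr0.
    by rewrite mulrDr mulrA (mulrC _ (k s0)) profile // -mulrA.
  have : 0 < x s0 ^+ 2 by rewrite exprn_even_gt0.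
  have : 0 <= m * N0 s0 ^+ 2 by rewrite mulr_ge0 ?sqr_ge0 ?ltW.
  lra.
- move=> s Is; have xs := xn0 Is.
  have du : is_derive s 1 (u_of n gamma) (- (2 * B * x1 s) / x s ^+ 3).
    have h := is_derive_ptM (is_derive_cst B s 1)
      (is_derive_ptV (f := fun r => x r * x r) (mulf_neq0 xs xs) (is_derive_ptM (dx Is) (dx Is))).
    have E : 0 * (x s * x s)^-1 + B * (- (x1 s * x s + x s * x1 s) / (x s * x s) ^+ 2) =
      - (2 * B * x1 s) / x s ^+ 3 by field.
    rewrite -E; apply: is_derive_local I_open Is _ h => r Ir.
    by rewrite u_profile // expr2.
  split; first by case: du.
  rewrite derive1E; case: du => _ ->.
  have uk : u_of n gamma s ^+ (2 * n) = k s ^+ 2.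
    rewrite mulnC exprM u_of_expn ?(ltW (kappa0 Is)) //.
    by rewrite (curvatureE I_open gamma_curve) // real_normK ?num_real.
  have kE : k s = m * N0 s / x s by rewrite -profile ?xn0 // mulfK // xn0.
  rewrite uk u_profile // kE /profile_a -/m.
  have NE : N0 s ^+ 2 = 1 + x s ^+ 2 - x1 s ^+ 2 by rewrite -axis_norm //; ring.
  transitivity (4 * B ^+ 2 / x s ^+ 6 * (1 + x s ^+ 2 - N0 s ^+ 2)).
    by rewrite NE; field.
  by field; rewrite xs n0 !gt_eqF.
Qed.

End FirstIntegral.
End Profile.

(** * Derivatives of the rotational parametrizations *)

Section Spread.
Variables (R : realType) (d : nat).
Implicit Types (v w : 'rV[R]_d).

(** The ambient space R^(2n+2) split as the space acted on by O(2n) and the two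
    coordinates that it fixes. *)
Definition spread v (b c : R) : 'rV[R]_(d + 1 + 1) := row_mx (row_mx v b%:M) c%:M.

Lemma spreadD v b c v' b' c' :
  spread v b c + spread v' b' c' = spread (v + v') (b + b') (c + c').
Proof. by rewrite /spread !add_row_mx !raddfD. Qed.

Lemma spreadZ a v b c : a *: spread v b c = spread (a *: v) (a * b) (a * c).
Proof. by rewrite /spread !scale_row_mx !scale_scalar_mx. Qed.

Lemma lorentz_spread v b c v' b' c' :
  lorentz (spread v b c) (spread v' b' c') = dot v v' + b * b' - c * c'.
Proof.
have dot1 (b1 b2 : R) : dot (b1%:M : 'rV_1) b2%:M = b1 * b2.
  by rewrite /dot big_ord1 !mxE !mulr1n.
rewrite /lorentz /spread !row_mxKl !row_mxKr dot1; congr (_ - _).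
rewrite -dot1 /dot big_split_ord /=; congr (_ + _); apply: eq_bigr => i _.
  by rewrite !row_mxEl.
by rewrite !row_mxEr.
Qed.

End Spread.

Section VectorDerivatives.
Variables (R : realType) (V : normedModType R) (d : nat).
Implicit Types (f b c : V -> R) (M P : V -> 'rV[R]_d).

Lemma is_derive_vecD M P q v (dM dP : 'rV[R]_d) :
  is_derive q v M dM -> is_derive q v P dP ->
  is_derive q v (fun p => M p + P p) (dM + dP).
Proof. exact: is_deriveD. Qed.

Lemma is_derive_vecZ f M q v (df : R) (dM : 'rV[R]_d) :
  is_derive q v f df -> is_derive q v M dM ->
  is_derive q v (fun p => f p *: M p) (df *: M q + f q *: dM).
Proof.
move=> hf hM; apply: is_derive_mx => i j; rewrite !mxE.
have := is_derive_ptM hf (is_derive_coord i j hM); congr (is_derive _ _ _ _).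
by apply/funext => p; rewrite mxE.
Qed.

Lemma is_derive_dot M P q v (dM dP : 'rV[R]_d) :
  is_derive q v M dM -> is_derive q v P dP ->
  is_derive q v (fun p => dot (M p) (P p)) (dot dM (P q) + dot (M q) dP).
Proof.
move=> hM hP; rewrite /dot -big_split /=.
by apply: is_derive_pt_sum => i; apply: is_derive_ptM; exact: is_derive_coord.
Qed.

Lemma is_derive_spread M b c q v (dM : 'rV[R]_d) (db dc : R) :
  is_derive q v M dM -> is_derive q v b db -> is_derive q v c dc ->
  is_derive q v (fun p => spread (M p) (b p) (c p)) (spread dM db dc).
Proof.
move=> hM hb hc; apply: is_derive_mx => i j.
case: (split_ordP j) => {}j ->.
  have E (v' : 'rV[R]_d) (b' c' : R) : spread v' b' c' i (lshift 1 j) = row_mx v' (b'%:M : 'M[R]_1) i j :> R.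
    by rewrite /spread row_mxEl.
  rewrite E; under eq_fun do rewrite E.
  case: (split_ordP j) => {E}j ->.
    rewrite row_mxEl; under eq_fun do rewrite row_mxEl.
    exact: is_derive_coord.
  rewrite row_mxEr; under eq_fun do rewrite row_mxEr.
  by rewrite !ord1 !mxE mulr1n; under eq_fun do rewrite mxE mulr1n.
have E (v' : 'rV[R]_d) (b' c' : R) : spread v' b' c' i (rshift (d + 1) j) = c' :> R.
  by rewrite /spread row_mxEr !ord1 mxE mulr1n.
by rewrite E; under eq_fun do rewrite E.
Qed.

End VectorDerivatives.

Section Rotation.
Variables (R : realType) (n : nat).
Implicit Types (p : 'rV[R]_(2 + 1)) (theta w : 'rV[R]_(2 * n)).

(** The vectors tangent to the orbits of O(2n). *)
Definition fibre w : 'rV[R]_(2 * n + 1 + 1) := spread w 0 0.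

Lemma rotateE p theta : rotate p theta = spread (p 0 i0 *: theta) (p 0 i1) (p 0 i2).
Proof. by []. Qed.

Lemma lorentz_rotate p p' theta : dot theta theta = 1 ->
  lorentz (rotate p theta) (rotate p' theta) = lorentz p p'.
Proof.
by move=> h; rewrite !rotateE lorentz_spread dotZl dotZr h lorentz3E mulr1.
Qed.

Lemma lorentz_rotate_fibre p theta w :
  lorentz (rotate p theta) (fibre w) = p 0 i0 * dot theta w.
Proof. by rewrite rotateE lorentz_spread dotZl; ring. Qed.

Lemma lorentz_fibre w w' : lorentz (fibre w) (fibre w') = dot w w'.
Proof. by rewrite lorentz_spread; ring. Qed.

Lemma rot_map_second_derivative (s s1 s2 c0 : R) p1 p2 (t0 t1 t2 t : 'rV[R]_(2 * n)) :
  spread ((s * p1 0 i0 + s2 * (p2 0 i0 * s1)) *: t0 + (s2 * p1 0 i0) *: t1 +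
      ((p1 0 i0 * s1) *: t2 + c0 *: t))
    (s * p1 0 i1 + s2 * (p2 0 i1 * s1)) (s * p1 0 i2 + s2 * (p2 0 i2 * s1)) =
  s *: rotate p1 t0 + (s1 * s2) *: rotate p2 t0 +
  fibre ((p1 0 i0 * s2) *: t1 + (p1 0 i0 * s1) *: t2 + c0 *: t).
Proof.
rewrite !rotateE /fibre !spreadZ !spreadD; congr spread.
- by apply/rowP => l; rewrite !mxE; ring.
- by ring.
- by ring.
Qed.

Lemma rot_map_normal_component (s s1 s2 c0 e : R) (p1 p2 N : 'rV[R]_(2 + 1))
    (t0 t1 t2 t : 'rV[R]_(2 * n)) :
  dot t0 t0 = 1 -> lorentz p1 N = 0 -> dot t0 t1 = 0 -> dot t0 t2 = 0 ->
  dot t0 t = - e ->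
  lorentz (s *: rotate p1 t0 + (s1 * s2) *: rotate p2 t0 +
      fibre ((p1 0 i0 * s2) *: t1 + (p1 0 i0 * s1) *: t2 + c0 *: t)) (rotate N t0) =
  lorentz p2 N * (s1 * s2) - c0 * N 0 i0 * e.
Proof.
move=> t00 p1N t01 t02 t0t; rewrite !lorentzDl !lorentzZl !lorentz_rotate //.
rewrite p1N [lorentz (fibre _) _]lorentzC lorentz_rotate_fibre !dotDr !dotZr.
by rewrite t01 t02 t0t; ring.
Qed.

End Rotation.

(** * Linear algebra of an immersed point *)

Section LorentzGram.
Variables (R : realType) (m d : nat).

Definition gram (D : 'M[R]_(m, d + 1)) : 'M[R]_m :=
  \matrix_(i, j) lorentz (row i D) (row j D).

(** Makes statements on the Gram matrix statements on combinations of the rows. *)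
Lemma mulmx_gram (D : 'M[R]_(m, d + 1)) (v : 'rV[R]_m) j :
  (v *m gram D) 0 j = lorentz (v *m D) (row j D).
Proof.
rewrite [v *m D]mulmx_sum_row lorentz_suml mxE; apply: eq_bigr => i _.
by rewrite mxE lorentzZl.
Qed.

Lemma lorentz_mulmx (D : 'M[R]_(m, d + 1)) (v : 'rV[R]_m) w :
  lorentz (v *m D) w = \sum_i v 0 i * lorentz (row i D) w.
Proof.
by rewrite mulmx_sum_row lorentz_suml; apply: eq_bigr => i _; rewrite lorentzZl.
Qed.

Lemma unitmx_of_injective (A : 'M[R]_m) : (forall v : 'rV[R]_m, v *m A = 0 -> v = 0) -> A \in unitmx.
Proof.
move=> H; rewrite -row_free_unit -kermx_eq0; apply/eqP/row_matrixP => i; rewrite row0.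
by apply: H; apply: sub_kermxP; exact: row_sub.
Qed.

End LorentzGram.

Section Frame.
Variables (R : realType) (m : nat).
Variables (D : 'M[R]_(m, m + 1 + 1)) (X nu : 'rV[R]_(m + 1 + 1)).
Hypotheses (G_unit : gram D \in unitmx) (X_unit : lorentz X X = -1)
  (nu_unit : lorentz nu nu = 1) (nuX : lorentz nu X = 0)
  (XD : forall i, lorentz X (row i D) = 0)
  (nuD : forall i, lorentz nu (row i D) = 0).

(** The tangent vectors, the position and the normal are m + 2 vectors of an
    (m+2)-dimensional space, and they are independent because their Lorentz Gram
    matrix is block diagonal with invertible blocks. *)
Lemma adapted_frame (w : 'rV[R]_(m + 1 + 1)) :
  exists (a : 'rV[R]_m) (b c : R), w = a *m D + b *: X + c *: nu.
Proof.
have Bu : col_mx (col_mx D X) nu \in unitmx.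
  apply: unitmx_of_injective => v; rewrite -[v]hsubmxK -[lsubmx v]hsubmxK !mul_row_col.
  move: (lsubmx (lsubmx v)) (rsubmx (lsubmx v)) (rsubmx v) => a b c.
  rewrite [b]mx11_scalar [c]mx11_scalar !mul_scalar_mx => E.
  have DX y : (forall i, lorentz y (row i D) = 0) -> lorentz (a *m D) y = 0.
    by move=> h; rewrite lorentz_mulmx big1 // => i _; rewrite lorentzC h mulr0.
  have b0 : b 0 0 = 0.
    have := congr1 (fun w => lorentz w X) E.
    rewrite !lorentzDl !lorentzZl DX // X_unit nuX lorentz0l; lra.
  have c0 : c 0 0 = 0.
    have := congr1 (fun w => lorentz w nu) E.
    rewrite !lorentzDl !lorentzZl DX // nu_unit (lorentzC X) nuX lorentz0l; lra.
  rewrite b0 c0 !scale0r !addr0 in E; rewrite b0 c0.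
  have -> : a = 0; last by rewrite !raddf0 !row_mx0.
  have : a *m gram D = 0.
    by apply/rowP => j; rewrite mulmx_gram E lorentz0l mxE.
  by move/(congr1 (mulmx^~ (invmx (gram D)))); rewrite mulmxK // mul0mx.
have : w = w *m invmx (col_mx (col_mx D X) nu) *m col_mx (col_mx D X) nu.
  by rewrite mulmxKV.
move: (w *m _) => v; rewrite -[v]hsubmxK -[lsubmx v]hsubmxK !mul_row_col.
move: (lsubmx (lsubmx v)) (rsubmx (lsubmx v)) (rsubmx v) => a b c.
by rewrite [b]mx11_scalar [c]mx11_scalar !mul_scalar_mx => E; exists a, (b 0 0), (c 0 0).
Qed.

Lemma lorentz_adapted (a : 'rV[R]_m) (b c : R) :
  let w := a *m D + b *: X + c *: nu in
  [/\ lorentz w X = - b, lorentz w nu = c &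
      forall j, lorentz w (row j D) = (a *m gram D) 0 j].
Proof.
have DX y : (forall i, lorentz y (row i D) = 0) -> lorentz (a *m D) y = 0.
  by move=> h; rewrite lorentz_mulmx big1 // => i _; rewrite lorentzC h mulr0.
split=> [||j]; rewrite !lorentzDl !lorentzZl.
- by rewrite DX // X_unit nuX; ring.
- by rewrite DX // nu_unit (lorentzC X) nuX; ring.
- by rewrite XD nuD mulmx_gram; ring.
Qed.

Lemma normal_colinear w : lorentz w X = 0 -> (forall j, lorentz w (row j D) = 0) ->
  w = lorentz w nu *: nu.
Proof.
have [a [b [c ->]]] := adapted_frame w; have [h1 -> h3] := lorentz_adapted a b c.
move=> wX h; have a0 : a *m gram D = 0 by apply/rowP => j; rewrite -h3 h mxE.
move: wX; rewrite h1 => /eqP; rewrite oppr_eq0 => /eqP ->.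
have -> : a = 0 by rewrite -[a](mulmxK G_unit) a0 mul0mx.
by rewrite mul0mx scale0r !add0r.
Qed.

(** The squared length of a tangent vector, computed from its covariant
    components with the inverse metric. *)
Lemma tangent_gram w : lorentz w X = 0 -> lorentz w nu = 0 ->
  let s := \row_j lorentz w (row j D) in
  (s *m invmx (gram D) *m s^T) 0 0 = lorentz w w.
Proof.
have [a [b [c E]]] := adapted_frame w; have [h1 h2 h3] := lorentz_adapted a b c.
rewrite {1 2}E h1 h2 => /eqP; rewrite oppr_eq0 => /eqP b0 c0 /=.
rewrite b0 c0 !scale0r !addr0 in h3 E.
have -> : \row_j lorentz w (row j D) = a *m gram D.
  by apply/rowP => j; rewrite mxE E h3.
rewrite mulmxK // [in RHS]E lorentz_mulmx mxE; apply: eq_bigr => j _.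
by rewrite mxE -h3 -E lorentzC.
Qed.

End Frame.

Section PointGeometry.
Variables (R : realType) (n : nat) (p0 p1 : 'rV[R]_(2 + 1)) (theta : 'rV[R]_(2 * n)).
Variables (s_ : 'I_(2 * n) -> R) (t_ : 'I_(2 * n) -> 'rV[R]_(2 * n)).
Hypotheses (n_gt0 : (0 < n)%N) (h00 : lorentz p0 p0 = -1) (h11 : lorentz p1 p1 = 1)
  (h01 : lorentz p0 p1 = 0) (theta1 : dot theta theta = 1)
  (theta_t : forall i, dot theta (t_ i) = 0).
Let x := p0 0 i0.
Let N := cross p0 p1.
Let X := rotate p0 theta.
Let T := rotate p1 theta.
Let nu0 := rotate N theta.
Definition tangent_rows : 'M[R]_(2 * n, 2 * n + 1 + 1) :=
  \matrix_i (s_ i *: rotate p1 theta + p0 0 i0 *: fibre (t_ i)).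
Let D := tangent_rows.

Let rowD i : row i D = s_ i *: T + x *: fibre (t_ i).
Proof. by rewrite rowK. Qed.

Lemma lorentz_rotate_row p i : lorentz (rotate p theta) (row i D) = s_ i * lorentz p p1.
Proof.
by rewrite rowD lorentzDr !lorentzZr lorentz_rotate // lorentz_rotate_fibre theta_t; ring.
Qed.

Lemma rot_gramE i j :
  lorentz (row i D) (row j D) = s_ i * s_ j + x ^+ 2 * dot (t_ i) (t_ j).
Proof.
rewrite {1}rowD lorentzDl !lorentzZl lorentz_rotate_row h11.
rewrite rowD lorentzDr !lorentzZr lorentz_fibre (lorentzC _ T) lorentz_rotate_fibre theta_t.
by ring.
Qed.

Hypothesis D_free : row_free D.

(** The Lorentz form is positive definite on the span of T and of the fibres
    orthogonal to theta, where T is the tangent vector of the meridian: a null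
    combination of the rows is zero. *)
Lemma rot_gram_unit : gram D \in unitmx.
Proof.
apply: unitmx_of_injective => v vG.
pose a := \sum_i v 0 i * s_ i; pose w := \sum_i v 0 i *: t_ i.
have vD : v *m D = a *: T + x *: fibre w.
  have fibre_sum : fibre w = \sum_i v 0 i *: fibre (t_ i).
    rewrite /w; elim/big_rec2: _ => [|i y1 y2 _ <-].
      by rewrite /fibre /spread !raddf0 !row_mx0.
    by rewrite /fibre spreadZ spreadD !mulr0 !addr0.
  rewrite mulmx_sum_row fibre_sum scaler_suml scaler_sumr -big_split /=.
  by apply: eq_bigr => i _; rewrite rowD scalerDr !scalerA [x * _]mulrC.
have v0 : lorentz (v *m D) (v *m D) = 0.
  rewrite [in X in lorentz X _]mulmx_sum_row lorentz_suml big1 // => i _.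
  by rewrite lorentzZl lorentzC -mulmx_gram vG mxE mulr0.
have thw : dot theta w = 0.
  rewrite /w; elim/big_rec: _ => [|i y _ h]; first by rewrite dotC dot0l.
  by rewrite dotDr dotZr theta_t h; ring.
have E : a ^+ 2 + (x ^+ 2 * dot w w) = 0.
  rewrite -v0 vD !lorentzDl !lorentzDr !lorentzZl !lorentzZr lorentz_rotate // h11.
  by rewrite (lorentzC _ T) lorentz_rotate_fibre lorentz_fibre thw; ring.
have a0 : a = 0.
  apply/eqP; rewrite -sqrf_eq0 eq_le sqr_ge0 andbT -E lerDl mulr_ge0 ?sqr_ge0 //.
  exact: dot_ge0.
have w0 : x *: w = 0.
  apply: dot_eq0; rewrite dotZl dotZr mulrA -expr2 -[RHS]E a0; ring.
have : v *m D = 0.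
  rewrite vD a0 scale0r add0r /fibre spreadZ w0 !mulr0 /spread.
  by rewrite !raddf0 !row_mx0.
by move=> vD0; apply: (row_free_inj D_free); rewrite vD0 mul0mx.
Qed.

(** On the axis all partial derivatives are multiples of one vector, whereas
    2 n > 1 independent ones are required. *)
Lemma rot_immersed_neq0 : x != 0.
Proof.
apply/eqP => x0.
have DE : D = (\col_i s_ i) *m T.
  apply/matrixP => i j; rewrite !mxE big_ord1 !mxE.
  by rewrite -/x x0 mul0r addr0.
have : (\rank D <= 1)%N by rewrite DE (leq_trans (mxrankM_maxl _ _)) ?rank_leq_col.
move: D_free; rewrite /row_free => /eqP ->; case: n n_gt0 => // l _.
by rewrite mulnS.
Qed.

Let nu0N : lorentz nu0 nu0 = 1.
Proof. by rewrite lorentz_rotate // frame_normal. Qed.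
Let nu0X : lorentz nu0 X = 0.
Proof. by rewrite lorentz_rotate // lorentz_cross. Qed.
Let nu0D i : lorentz nu0 (row i D) = 0.
Proof. by rewrite lorentz_rotate_row lorentz_cross mulr0. Qed.
Let XX : lorentz X X = -1. Proof. by rewrite lorentz_rotate. Qed.
Let XD i : lorentz X (row i D) = 0.
Proof. by rewrite lorentz_rotate_row h01 mulr0. Qed.

Lemma rot_normal nu : lorentz nu nu = 1 -> lorentz nu X = 0 ->
  (forall i, lorentz nu (row i D) = 0) -> exists2 c, c ^+ 2 = 1 & nu = c *: nu0.
Proof.
move=> h1 h2 h3.
have E := normal_colinear rot_gram_unit XX nu0N nu0X XD nu0D h2 h3.
exists (lorentz nu nu0) => //.
by rewrite -h1 [in RHS]E lorentzZl lorentzZr nu0N; ring.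
Qed.

(** With s the row of the inner products of T and the coordinate vectors, the
    second form is c (k + N_1 / x) s^T s - c (N_1 / x) G for G the metric. The
    trace of G^(-1) s^T s is the squared length of T, which is 1, and that of
    G^(-1) G is 2 n. *)
Lemma rot_trace (k c : R) (H : 'M[R]_(2 * n)) :
  (forall i j, H i j = c * (k * (s_ i * s_ j) - x * N 0 i0 * dot (t_ i) (t_ j))) ->
  \tr (invmx (gram D) *m H) = c * (k * x - (2 * n%:R - 1) * N 0 i0) / x.
Proof.
move=> HE; have x0 := rot_immersed_neq0.
pose s := \row_j lorentz T (row j D).
have sE j : s 0 j = s_ j by rewrite mxE lorentz_rotate_row h11 mulr1.
have -> : H = (c * (k + N 0 i0 / x)) *: (s^T *m s) - (c * N 0 i0 / x) *: gram D.
  have combE (al be : R) (A B : 'M[R]_(2 * n)) i j :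
      (al *: A - be *: B) i j = al * A i j - be * B i j by rewrite !mxE.
  apply/matrixP => i j; rewrite HE combE [gram D i j]mxE rot_gramE.
  rewrite [(s^T *m s) i j]mxE big_ord1 [s^T i 0]mxE !sE.
  by field.
rewrite mulmxBr -!scalemxAr [\tr _]raddfB /= !mxtraceZ mulVmx ?rot_gram_unit // mxtrace1.
rewrite mulmxA mxtrace_mulC mulmxA trace_mx11.
have TX : lorentz T X = 0 by rewrite lorentz_rotate // lorentzC.
have Tnu : lorentz T nu0 = 0 by rewrite lorentz_rotate // lorentzC lorentz_cross.
rewrite (tangent_gram rot_gram_unit XX nu0N nu0X XD nu0D TX Tnu) lorentz_rotate // h11.
by rewrite natrM; field.
Qed.

End PointGeometry.

(** * The fundamental forms of a rotational hypersurface *)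

Section Patch.
Variables (R : realType) (n : nat) (I : set R) (gamma : R -> 'rV[R]_(2 + 1)).
Hypotheses (n_gt0 : (0 < n)%N) (I_open : open I)
  (gamma_curve : arc_length_curve I gamma).
Variables (U : set 'rV[R]_(2 * n)) (sigma : 'rV[R]_(2 * n) -> R)
  (theta : 'rV[R]_(2 * n) -> 'rV[R]_(2 * n)).
Hypothesis patch : smooth_patch I U sigma theta.
Let X := rot_map gamma sigma theta.

Let oU : open U. Proof. by case: patch. Qed.
Let Is q : U q -> I (sigma q). Proof. by case: patch => _ _ _ /[apply] -[]. Qed.
Let theta1 q : U q -> dot (theta q) (theta q) = 1.
Proof. by case: patch => _ _ _ /[apply] -[]. Qed.

Let S i q : R := 'D_'e_i sigma q.
Let Th i q : 'rV[R]_(2 * n) := 'D_'e_i theta q.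

Let dsigma i q : U q -> is_derive q 'e_i sigma (S i q).
Proof.
by case: patch => _ /(_ 1 i)[h _] _ _ Uq; apply: derivableP; exact: h.
Qed.

Let dS i j q : U q -> is_derive q 'e_i (S j) ('D_'e_i (S j) q).
Proof.
by case: patch => _ /(_ 2 j)[_ /(_ i)[h _]] _ _ Uq; apply: derivableP; exact: h.
Qed.

Let dtheta i q : U q -> is_derive q 'e_i theta (Th i q).
Proof.
by case: patch => _ _ /(_ 1 i)[h _] _ Uq; apply: derivableP; exact: h.
Qed.

Let dTh i j q : U q -> is_derive q 'e_i (Th j) ('D_'e_i (Th j) q).
Proof.
by case: patch => _ _ /(_ 2 j)[_ /(_ i)[h _]] _ Uq; apply: derivableP; exact: h.
Qed.

Lemma theta_Th i q : U q -> dot (theta q) (Th i q) = 0.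
Proof.
move=> Uq; have := is_derive_dot (dtheta i Uq) (dtheta i Uq).
move=> /(is_derive_local_cst oU Uq theta1).
by rewrite (dotC (Th i q)); lra.
Qed.

(** The derivative of the orthogonality of theta to its partial derivatives. *)
Lemma theta_dTh i j q : U q -> dot (theta q) ('D_'e_i (Th j) q) = - dot (Th i q) (Th j q).
Proof.
move=> Uq; have := is_derive_dot (dtheta i Uq) (dTh i j Uq).
by move=> /(is_derive_local_cst oU Uq (theta_Th j)); lra.
Qed.

Let jetc l i q : R := jet gamma l (sigma q) 0 i.

Let djetc l i j q : U q -> is_derive q 'e_j (jetc l i) (jetc l.+1 i q * S j q).
Proof.
move=> Uq; exact: (is_derive_chain (g := fun s => jet gamma l s 0 i)
  (is_derive_coord 0 i (is_derive_jet gamma_curve l (Is Uq))) (dsigma j Uq)).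
Qed.

Lemma is_derive_rot_map j q : U q ->
  is_derive q 'e_j X (S j q *: rotate (jet gamma 1 (sigma q)) (theta q) +
    jetc 0 i0 q *: fibre (Th j q)).
Proof.
move=> Uq; have := is_derive_spread (is_derive_vecZ (djetc 0 i0 j Uq) (dtheta j Uq))
  (djetc 0 i1 j Uq) (djetc 0 i2 j Uq).
congr (is_derive _ _ _ _); rewrite rotateE /fibre !spreadZ spreadD.
by rewrite scalerA !mulr0 !addr0 ![S j q * _]mulrC.
Qed.

Lemma is_derive2_rot_map i j q : U q ->
  is_derive q 'e_i (fun p => 'D_'e_j X p)
   ('D_'e_i (S j) q *: rotate (jet gamma 1 (sigma q)) (theta q) +
    (S i q * S j q) *: rotate (jet gamma 2 (sigma q)) (theta q) +
    fibre ((jetc 1 i0 q * S j q) *: Th i q + (jetc 1 i0 q * S i q) *: Th j q +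
      jetc 0 i0 q *: 'D_'e_i (Th j) q)).
Proof.
move=> Uq.
have h l := is_derive_ptM (dS i j Uq) (djetc 1 l i Uq).
have hv := is_derive_vecD (is_derive_vecZ (h i0) (dtheta i Uq))
  (is_derive_vecZ (djetc 0 i0 i Uq) (dTh i j Uq)).
have := is_derive_spread hv (h i1) (h i2).
move=> H; apply: (is_derive_local oU Uq _ (_ : is_derive q 'e_i (fun p =>
  spread ((S j p * jetc 1 i0 p) *: theta p + jetc 0 i0 p *: Th j p)
   (S j p * jetc 1 i1 p) (S j p * jetc 1 i2 p)) _)).
  move=> p Up; case: (is_derive_rot_map j Up) => _ ->.
  by rewrite rotateE /fibre !spreadZ spreadD scalerA !mulr0 !addr0.
move: H; congr (is_derive _ _ _ _).
exact: rot_map_second_derivative.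
Qed.

Let x q := jet gamma 0 (sigma q) 0 i0.
Let N0 q := normal gamma (sigma q) 0 i0.
Let k q := scurv gamma (sigma q).
Let m : R := 2 * n%:R - 1.

Let D q := tangent_rows (jet gamma 0 (sigma q)) (jet gamma 1 (sigma q)) (theta q)
  (S ^~ q) (Th ^~ q).

Let DE j q : U q -> 'D_'e_j X q = row j (D q).
Proof. by move=> Uq; rewrite rowK; case: (is_derive_rot_map j Uq). Qed.

Let j00 q (Uq : U q) := jet00 gamma_curve (Is Uq).
Let j11 q (Uq : U q) := jet11 gamma_curve (Is Uq).
Let j01 q (Uq : U q) := jet01 I_open gamma_curve (Is Uq).

Lemma first_form_rot q : U q -> first_form X q =
  \matrix_(i, j) ('D_'e_i sigma q * 'D_'e_j sigma q +
    x q ^+ 2 * dot ('D_'e_i theta q) ('D_'e_j theta q)).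
Proof.
move=> Uq; apply/matrixP => i j; rewrite [LHS]mxE [RHS]mxE !DE //.
exact: (rot_gramE _ _ (j11 Uq) (theta1 Uq) (fun i => theta_Th i Uq)).
Qed.

Let gramE q : U q -> first_form X q = gram (D q).
Proof. by move=> Uq; apply/matrixP => i j; rewrite !mxE !DE. Qed.

Let immersedE q : U q -> immersed_at X q -> row_free (D q).
Proof.
move=> Uq; rewrite /immersed_at; congr row_free.
by apply/row_matrixP => i; rewrite rowK DE.
Qed.

Lemma rot_map_unit_normal q : U q ->
  unit_normal X q (rotate (normal gamma (sigma q)) (theta q)).
Proof.
move=> Uq; split=> [||i].
- by rewrite lorentz_rotate ?theta1 // (normal_unit I_open gamma_curve (Is Uq)).
- by rewrite lorentz_rotate ?theta1 // lorentz_cross.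
- rewrite DE //.
  rewrite (lorentz_rotate_row _ _ _ (theta1 Uq) (fun i => theta_Th i Uq)).
  by rewrite lorentz_cross mulr0.
Qed.

Lemma second_form_normal q i j : U q ->
  lorentz ('D_'e_i (fun p => 'D_'e_j X p) q) (rotate (normal gamma (sigma q)) (theta q)) =
  k q * (S i q * S j q) - x q * N0 q * dot (Th i q) (Th j q).
Proof.
move=> Uq; case: (is_derive2_rot_map i j Uq) => _ ->.
apply: rot_map_normal_component.
- exact: theta1.
- by rewrite lorentzC (lorentz_cross _ _).2.
- exact: theta_Th.
- exact: theta_Th.
- exact: theta_dTh.
Qed.

Lemma immersed_neq0 q : U q -> immersed_at X q -> x q != 0.
Proof.
move=> Uq /(immersedE Uq); exact: rot_immersed_neq0.
Qed.

(** The normal line is one-dimensional, so nu is the rotated normal of gamma up to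
    the sign c. *)
Lemma second_form_rot q nu : U q -> immersed_at X q -> unit_normal X q nu ->
  exists c, [/\ c ^+ 2 = 1,
    forall i j, second_form X q nu i j =
      c * (k q * (S i q * S j q) - x q * N0 q * dot (Th i q) (Th j q)) &
    mean_curvature X q nu = (2 * n)%:R^-1 * (c * (k q * x q - m * N0 q) / x q)].
Proof.
move=> Uq iq [h1 h2 h3]; have Df := immersedE Uq iq.
have [c c2 nuE] : exists2 c, c ^+ 2 = 1 & nu = c *: rotate (normal gamma (sigma q)) (theta q).
  apply: (rot_normal (j00 Uq) (j11 Uq) (j01 Uq) (theta1 Uq)
    (fun i => theta_Th i Uq) Df) => // i.
  by rewrite -DE.
have hE i j : second_form X q nu i j =
    c * (k q * (S i q * S j q) - x q * N0 q * dot (Th i q) (Th j q)).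
  by rewrite mxE nuE lorentzZr second_form_normal.
exists c; split => //.
rewrite /mean_curvature gramE //; congr (_ * _).
exact: (rot_trace n_gt0 (j00 Uq) (j11 Uq) (j01 Uq) (theta1 Uq)
    (fun i => theta_Th i Uq) Df hE).
Qed.

End Patch.

(** * Smooth patches through every point *)

Section Smooth.
Variables (R : realType) (d : nat).

(** Smoothness of all members of a class of functions that is stable under partial
    derivatives. A proof by induction on the order for a single operation would
    have to carry all lower orders along. *)
Lemma smooth_coinduction (V : normedModType R) (A : ('rV[R]_d -> V) -> Prop) :
  (forall f, A f -> continuous f) ->
  (forall f i, A f -> exists2 g, A g & forall q, is_derive q 'e_i f (g q)) ->
  forall f U, A f -> smooth_on U f.
Proof.
move=> Ac Ad f U Af k; elim: k f Af => [|k IH] f Af /=.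
  by move=> q _; exact: Ac.
move=> i; have [g Ag dg] := Ad f i Af; split.
  by move=> q _; case: (dg q).
suff -> : (fun q => 'D_'e_i f q) = g by exact: IH.
by apply/funext => q; case: (dg q).
Qed.

(** A class stable under differentiation and large enough for stereographic
    projection. *)
Inductive rational : ('rV[R]_d -> R) -> Prop :=
| rational_cst c : rational (fun=> c)
| rational_coord i : rational (fun q => q 0 i)
| rational_add f g : rational f -> rational g -> rational (fun q => f q + g q)
| rational_mul f g : rational f -> rational g -> rational (fun q => f q * g q)
| rational_inv f : rational f -> (forall q, f q != 0) -> rational (fun q => (f q)^-1).

Lemma rational_opp f : rational f -> rational (fun q => - f q).
Proof.
move=> rf; have := rational_mul (rational_cst (-1)) rf.
by congr rational; apply/funext => q; rewrite mulN1r.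
Qed.

Lemma rational_sum (J : finType) (F : J -> 'rV[R]_d -> R) :
  (forall j, rational (F j)) -> rational (fun q => \sum_j F j q).
Proof.
move=> rF; elim: (index_enum J) => [|j s IH].
  by under eq_fun do rewrite big_nil; exact: rational_cst.
by under eq_fun do rewrite big_cons; exact: rational_add.
Qed.

Lemma rational_continuous f : rational f -> continuous f.
Proof.
elim=> {f} [c|i|f g _ cf _ cg|f g _ cf _ cg|f _ cf f0] q.
- exact: cst_continuous.
- exact: coord_continuous.
- exact: continuousD (cf q) (cg q).
- exact: continuousM (cf q) (cg q).
- exact: continuousV (f0 q) (cf q).
Qed.

Lemma is_derive_coordinate i (q v : 'rV[R]_d) :
  is_derive q v (fun p : 'rV[R]_d => p 0 i) (v 0 i).
Proof. exact: is_derive_coord (is_derive_id q v). Qed.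

Lemma rational_derive f v : rational f ->
  exists2 g, rational g & forall q, is_derive q v f (g q).
Proof.
elim=> {f} [c|i|f g rf [f' rf' df] rg [g' rg' dg]|f g rf [f' rf' df] rg [g' rg' dg]|f rf [f' rf' df] f0].
- by exists (fun=> 0) => [|q]; [exact: rational_cst|exact: is_derive_cst].
- exists (fun=> v 0 i) => [|q]; first exact: rational_cst.
  exact: is_derive_coordinate.
- exists (fun q => f' q + g' q) => [|q]; first exact: rational_add.
  exact: is_derive_ptD.
- exists (fun q => f' q * g q + f q * g' q) => [|q].
    by apply: rational_add; apply: rational_mul.
  exact: is_derive_ptM.
- exists (fun q => - f' q * ((f q)^-1 * (f q)^-1)) => [|q].
    apply: rational_mul; first exact: rational_opp.
    by apply: rational_mul; exact: rational_inv.
  by rewrite -invfM; exact: is_derive_ptV (f0 q) (df q).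
Qed.

Lemma rational_smooth U f : rational f -> smooth_on U f.
Proof.
apply: smooth_coinduction f U; first exact: rational_continuous.
by move=> f i; exact: rational_derive.
Qed.

Lemma continuous_row m (F : 'rV[R]_d -> 'rV[R]_m) :
  (forall j, continuous (fun q => F q 0 j)) -> continuous F.
Proof.
move=> cF q A [P FP PA].
have : \forall p \near q, forall i j, P i j (F p i j).
  have H (i : 'I_1) (j : 'I_m) : \forall p \near q, P i j (F p i j).
    have h := FP i j; rewrite (ord1 i) in h *.
    exact: (cF j q (P 0 j) h).
  apply: (filter_forall (nbhs_filter q)) => i.
  by apply: (filter_forall (nbhs_filter q)) => j; exact: H.
by apply: filterS => p Pp; apply: PA.
Qed.

Lemma rational_row_smooth m U (F : 'rV[R]_d -> 'rV[R]_m) :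
  (forall j, rational (fun q => F q 0 j)) -> smooth_on U F.
Proof.
move=> rF; apply: (@smooth_coinduction _
  (fun G : 'rV[R]_d -> 'rV[R]_m => forall j, rational (fun q => G q 0 j))) rF.
  by move=> G rG; apply: continuous_row => j; exact: rational_continuous.
move=> G i rG.
have /choice[g hg] : forall j, exists g, rational g /\
    forall q, is_derive q 'e_i (fun q => G q 0 j) (g q).
  by move=> j; have [g rg dg] := rational_derive 'e_i (rG j); exists g.
exists (fun q => \row_j g j q).
  by move=> j; case: (hg j) => rg _; under eq_fun do rewrite mxE.
move=> q; apply: is_derive_mx => l j; rewrite mxE (ord1 l).
by case: (hg j) => _; exact.
Qed.

End Smooth.

Section SpherePatch.
Variables (R : realType) (d : nat) (z : 'I_d).
Implicit Types q : 'rV[R]_d.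

Definition tail_sqr q : R := \sum_i (if i == z then 0 else q 0 i * q 0 i).
Definition stereo_num q j : R := if j == z then 1 - tail_sqr q else 2 * q 0 j.
(** The inverse stereographic projection of the hyperplane orthogonal to the
    coordinate vector e_z, precomposed with the projection onto this hyperplane.
    As it does not depend on the coordinate z, that coordinate is free to
    parametrize the curve. *)
Definition stereo q : 'rV[R]_d := \row_j (stereo_num q j / (1 + tail_sqr q)).

Lemma tail_sqr_neq0 q : 1 + tail_sqr q != 0.
Proof.
rewrite gt_eqF // ltr_pwDl // sumr_ge0 // => i _; case: ifP => // _.
by rewrite -expr2 sqr_ge0.
Qed.

Lemma rational_tail_sqr : rational tail_sqr.
Proof.
apply: rational_sum => i; case: (i == z); first exact: rational_cst.
by apply: rational_mul; exact: rational_coord.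
Qed.

Lemma rational_stereo j : rational (fun q => stereo q 0 j).
Proof.
under eq_fun do rewrite mxE; apply: rational_mul; last first.
  apply: rational_inv tail_sqr_neq0.
  exact: (@rational_add _ _ (fun=> 1) _ (rational_cst _ 1) rational_tail_sqr).
rewrite /stereo_num; case: (j == z).
  exact: (@rational_add _ _ (fun=> 1) _ (rational_cst _ 1) (rational_opp rational_tail_sqr)).
exact: (@rational_mul _ _ (fun=> 2) _ (rational_cst _ 2) (rational_coord _ j)).
Qed.

Lemma stereo_unit q : dot (stereo q) (stereo q) = 1.
Proof.
have E : \sum_j stereo_num q j ^+ 2 = (1 + tail_sqr q) ^+ 2.
  rewrite (bigD1 z) //= /stereo_num eqxx.
  rewrite (eq_bigr (fun j => 4 * (q 0 j * q 0 j))); last first.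
    by move=> j /negPf ->; ring.
  rewrite -mulr_sumr.
  have -> : \sum_(i | i != z) q 0 i * q 0 i = tail_sqr q.
    rewrite /tail_sqr [RHS](bigD1 z) //= eqxx add0r.
    by apply: eq_bigr => j /negPf ->.
  by ring.
rewrite /dot (eq_bigr (fun j => stereo_num q j ^+ 2 * (1 + tail_sqr q) ^- 2)).
  by rewrite -mulr_suml E mulfV // expf_neq0 // tail_sqr_neq0.
by move=> j _; rewrite !mxE -exprVn; ring.
Qed.

Lemma derive_stereo (s : R) i : is_derive (s *: 'e_z : 'rV[R]_d) 'e_i stereo
  ((2 * (i != z)%:R) *: 'e_i).
Proof.
set q := s *: 'e_z.
have qj j : j != z -> q 0 j = 0.
  by move=> jz; rewrite !mxE eqxx (negPf jz) mulr0.
have t0 : tail_sqr q = 0.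
  by apply: big1 => j _; case: eqP => // /eqP /qj ->; rewrite mulr0.
have dt : is_derive q 'e_i tail_sqr 0.
  rewrite (_ : 0 = \sum_(j < d) (0 : R)); last by rewrite big1.
  apply: is_derive_pt_sum => j; case: eqP => [_|/eqP jz]; first exact: is_derive_cst.
  have := is_derive_ptM (is_derive_coordinate j q 'e_i) (is_derive_coordinate j q 'e_i).
  by rewrite qj // mulr0 mul0r addr0.
apply: is_derive_mx => l j; rewrite (ord1 l) {l}.
have dn : is_derive q 'e_i (stereo_num ^~ j) (2 * (i != z)%:R * (j == i)%:R).
  rewrite /stereo_num; case: eqP => [->|/eqP jz].
    have := is_derive_ptB (is_derive_cst (1 : R) q 'e_i) dt.
    by congr (is_derive _ _ _ _); rewrite (eq_sym i); case: (z == i); rewrite /= ?mulr0 ?mulr1 ?subr0 ?mul0r.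
  have := is_derive_ptM (is_derive_cst (2 : R) q 'e_i) (is_derive_coordinate j q 'e_i).
  congr (is_derive _ _ _ _); rewrite !mxE eqxx mul0r add0r /=.
  by case: (j =P i) => [<-|_] /=; rewrite ?mulr0 // jz /= !mulr1.
have := is_derive_ptM dn (is_derive_ptV (f := fun p => cst 1 p + tail_sqr p) (tail_sqr_neq0 q)
  (is_derive_ptD (is_derive_cst (1 : R) q 'e_i) dt)).
congr (is_derive _ _ _ _).
  by apply/funext => p; rewrite mxE.
by rewrite !mxE eqxx /= t0 !addr0 oppr0 mul0r mulr0 addr0 invr1 mulr1.
Qed.

End SpherePatch.

(** The coordinate z is the arc length of the meridian; the others are stereographic
    coordinates of the sphere, evaluated at their centre. *)
Lemma smooth_patch_exists (R : realType) (n : nat) (I : set R) (s : R) :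
  (0 < n)%N -> open I -> I s ->
  exists (z : 'I_(2 * n)) (U : set 'rV[R]_(2 * n)) sigma theta q,
    [/\ smooth_patch I U sigma theta, U q, sigma q = s,
        forall i, 'D_'e_i sigma q = (i == z)%:R &
        forall i, 'D_'e_i theta q = (2 * (i != z)%:R) *: 'e_i].
Proof.
move=> n_gt0 I_open Is; have z_lt : (0 < 2 * n)%N by rewrite muln_gt0.
pose z := Ordinal z_lt; pose sigma (q : 'rV[R]_(2 * n)) : R := q 0 z.
exists z, (sigma @^-1` I), sigma, (stereo z), (s *: 'e_z); split.
- split.
  + by apply: open_comp I_open => q _; exact: coord_continuous.
  + exact: (@rational_smooth _ _ _ sigma (rational_coord R z)).
  + exact: (@rational_row_smooth _ _ _ _ (stereo z) (@rational_stereo _ _ z)).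
  + by move=> q Uq; split => //; exact: stereo_unit.
- by rewrite /= /sigma !mxE !eqxx mulr1.
- by rewrite /sigma !mxE !eqxx mulr1.
- move=> i; case: (is_derive_coordinate z (s *: 'e_z : 'rV[R]_(2 * n)) 'e_i) => _ ->.
  by rewrite mxE eqxx eq_sym.
- by move=> i; case: (derive_stereo z s i).
Qed.

(** * Geometric conditions in terms of the profile *)

Section Characterizations.
Variables (R : realType) (n : nat) (I : set R) (gamma : R -> 'rV[R]_(2 + 1)).
Hypotheses (n_gt0 : (0 < n)%N) (I_open : open I)
  (gamma_curve : arc_length_curve I gamma).
Let x s : R := jet gamma 0 s 0 i0.

(** In the patch of smooth_patch_exists the metric is diagonal, with entries 1
    and 4 x^2. *)
Lemma immersed_patch_exists s : I s -> x s != 0 ->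
  exists U sigma theta q, [/\ smooth_patch I U sigma theta, U q, sigma q = s &
    immersed_at (rot_map (n := n) gamma sigma theta) q].
Proof.
move=> Is xs.
have [z [U [sigma [theta [q [patch Uq qs dS dTh]]]]]] := smooth_patch_exists n_gt0 I_open Is.
exists U, sigma, theta, q; split => //.
set X := rot_map gamma sigma theta; rewrite /immersed_at.
set D := \matrix_(i < 2 * n) 'D_'e_i X q.
have GE i j : gram D i j = (i == j)%:R * (if i == z then 1 else 4 * x s ^+ 2).
  have := first_form_rot gamma_curve patch Uq => /matrixP /(_ i j).
  rewrite [X in X = _ -> _]mxE [X in _ = X -> _]mxE !dS !dTh qs -/(x s).
  rewrite [gram D i j]mxE !rowK => ->.
  have e_dot : dot ('e_i : 'rV[R]_(2 * n)) 'e_j = (i == j)%:R.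
    rewrite /dot (bigD1 i) //= big1 => [|l li]; last first.
      by rewrite !mxE (negPf li) andbF mul0r.
    by rewrite !mxE !eqxx mul1r addr0.
  rewrite dotZl dotZr e_dot; have [<-|ij] := eqVneq i j.
    by case: (i == z) => /=; ring.
  have [iz|_] := eqVneq i z; last by rewrite /=; ring.
  by rewrite -iz eq_sym (negPf ij) /=; ring.
rewrite -kermx_eq0; apply/eqP/row_matrixP => l; rewrite row0.
set v := row l _; have vD : v *m D = 0 by apply: sub_kermxP; exact: row_sub.
apply/rowP => j; have := mulmx_gram D v j; rewrite vD lorentz0l mxE.
rewrite (bigD1 j) //= big1 => [|i ij]; last by rewrite GE (negPf ij) mul0r mulr0.
rewrite GE eqxx mul1r addr0 => /eqP; rewrite mulf_eq0 => /orP[/eqP ->|].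
  by rewrite mxE.
by case: (j == z); rewrite ?oner_eq0 // mulf_eq0 pnatr_eq0 /= expf_eq0 (negPf xs).
Qed.

(** The mean curvature is proportional to k x - m N_1 with a nonzero factor, and
    every point of the curve off the axis is reached by an immersed patch; the
    points on the axis are reached by none. *)
Lemma minimal_profile : minimal n I gamma <-> profile_eq n I gamma.
Proof.
split=> [mini s Is xs|prof U sigma theta patch q Uq iq nu unu].
  have [U [sigma [theta [q [patch Uq qs iq]]]]] := immersed_patch_exists Is xs.
  have unu := rot_map_unit_normal I_open gamma_curve patch Uq.
  have := mini U sigma theta patch q Uq iq _ unu.
  have [c [c2 _ ->]] := second_form_rot n_gt0 I_open gamma_curve patch Uq iq unu.
  rewrite qs => /eqP; rewrite mulf_eq0 invr_eq0 pnatr_eq0 muln_eq0 /= -[n == 0%N]negbK -lt0n n_gt0 /=.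
  have c0 : c != 0 by apply: contra_eq_neq c2 => ->; rewrite expr0n eq_sym oner_eq0.
  by rewrite !mulf_eq0 invr_eq0 (negPf c0) (negPf xs) orbF /= subr_eq0 => /eqP.
have xq := immersed_neq0 n_gt0 gamma_curve patch Uq iq.
have [c [_ _ ->]] := second_form_rot n_gt0 I_open gamma_curve patch Uq iq unu.
have Is : I (sigma q) by case: patch => _ _ _ /(_ _ Uq)[].
by rewrite prof // subrr mulr0 mul0r mulr0.
Qed.

(** The induced metric is ds^2 + x^2 g, and the fibre has positive dimension, so
    that the factor of g can be read off. *)
Lemma warped_product_sqr f : warped_product n I gamma f <->
  (forall s, I s -> 0 < f s /\ x s ^+ 2 = f s ^+ 2).
Proof.
split=> [[f0 W] s Is|H].
  split; first exact: f0.
  have [z [U [sigma [theta [q [patch Uq qs dS dTh]]]]]] := smooth_patch_exists n_gt0 I_open Is.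
  have := W U sigma theta patch q Uq.
  rewrite (first_form_rot gamma_curve patch Uq).
  have [i iz] : exists i, i != z.
    have l1 : (1 < 2 * n)%N by case: n n_gt0 => // l _; rewrite mulnS.
    have [<-|] := eqVneq (Ordinal l1) z; last by exists (Ordinal l1).
    by exists (Ordinal (ltnW l1)).
  move=> /matrixP /(_ i i); rewrite !mxE qs dS !dTh (negPf iz) /= mulr0 !add0r.
  apply: mulIf; rewrite dotZl dotZr mulr1 /dot (bigD1 i) //= big1 => [|l li]; last first.
    by rewrite !mxE (negPf li) andbF mul0r.
  by rewrite !mxE !eqxx addr0 mul1r mulr1 mulf_neq0 ?pnatr_eq0.
split=> [s /H[]//|U sigma theta patch q Uq].
have Is : I (sigma q) by case: patch => _ _ _ /(_ _ Uq)[].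
have [_ <-] := H _ Is.
by rewrite (first_form_rot gamma_curve patch Uq).
Qed.

Lemma not_totally_geodesic : ~ totally_geodesic n I gamma ->
  exists s, [/\ I s, x s != 0 & scurv gamma s != 0 \/ normal gamma s 0 i0 != 0].
Proof.
move=> ntg; apply: contrapT => H; apply: ntg => U sigma theta patch q Uq iq nu unu.
have xq := immersed_neq0 n_gt0 gamma_curve patch Uq iq.
have Is : I (sigma q) by case: patch => _ _ _ /(_ _ Uq)[].
have [c [_ hE _]] := second_form_rot n_gt0 I_open gamma_curve patch Uq iq unu.
have k0 : scurv gamma (sigma q) = 0.
  by apply/eqP; apply: contrapT => /negP h; apply: H; exists (sigma q); split => //; left.
have N0 : normal gamma (sigma q) 0 i0 = 0.
  by apply/eqP; apply: contrapT => /negP h; apply: H; exists (sigma q); split => //; right.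
by apply/matrixP => i j; rewrite hE k0 N0 mxE; ring.
Qed.

End Characterizations.

(** * The axis determined by a solution *)

Section Reconstruction.
Variables (R : realType) (n : nat) (I : set R) (gamma : R -> 'rV[R]_(2 + 1)) (a : R).
Hypotheses (n_gt0 : (0 < n)%N) (I_open : open I) (I_itv : is_interval I)
  (gamma_curve : arc_length_curve I gamma) (a_gt0 : 0 < a)
  (EL : euler_lagrange n a I gamma).
Let m : R := 2 * n%:R - 1.
Let f := warping n a gamma.
Let f1 := warping1 n gamma a.
Let f2 := warping2 n gamma a.
Let k := scurv gamma.
Let m0 : 0 < m. Proof. exact: m_gt0. Qed.
Let df s (Is : I s) := is_derive_warping n_gt0 I_open gamma_curve EL Is.
Let df1 s (Is : I s) := is_derive_warping1 n_gt0 I_open gamma_curve EL Is.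
Let f2E s (Is : I s) := warping_second_order n_gt0 I_open I_itv gamma_curve a_gt0 EL Is.
Let f1E s (Is : I s) := warping_first_integral n_gt0 I_open gamma_curve a_gt0 EL Is.
Let kf1E s (Is : I s) := warping_curvature n_gt0 I_open gamma_curve EL Is.

(** The second-order equation of the warping function, transported to any curve
    with the same curvature whose first coordinate is a multiple of it. *)
Lemma warping_profile (delta : R -> 'rV[R]_(2 + 1)) (e : R) :
  arc_length_curve I delta ->
  (forall s, I s -> curvature delta s = curvature gamma s) ->
  (forall s, I s -> jet delta 0 s 0 i0 = e * f s) -> profile_eq n I delta.
Proof.
move=> delta_curve kE xE.
have dx s (Is : I s) := is_derive_coord 0 i0 (is_derive_jet delta_curve 0 Is).
have x1E s : I s -> jet delta 1 s 0 i0 = e * f1 s.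
  move=> Is; have := is_derive_ptM (is_derive_cst e s 1) (df Is).
  rewrite mul0r add0r => /(is_derive_local I_open Is (fun r Ir => esym (xE r Ir))).
  exact: is_derive_unique (dx s Is).
apply: (second_order_profile_eq n_gt0 I_open delta_curve) => s Is.
  by rewrite kE //; case: EL => h _ _; exact: h.
have := is_derive_ptM (is_derive_cst e s 1) (df1 Is).
move=> /(is_derive_local I_open Is (fun r Ir => esym (x1E r Ir))).
congr (is_derive _ _ _ _).
have aux F F1 F2 K x Kd : x = e * F -> Kd = K -> F2 = F + K * F / m ->
    0 * F1 + e * F2 = x + Kd * x / m by move=> -> -> ->; ring.
apply: aux (xE s Is) _ (f2E Is).
have kE2 := congr1 (fun z => z ^+ 2) (kE s Is).
exact: etrans (esym (curvature_sqr I_open delta_curve Is))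
  (etrans kE2 (curvature_sqr I_open gamma_curve Is)).
Qed.

(** The vector of the ambient space whose inner products with gamma, gamma' and
    the normal are those that the vector along the x_1-axis must have if f is the
    first coordinate. *)
Definition axis_at s : 'rV[R]_(2 + 1) :=
  f1 s *: jet gamma 1 s + (k s * f s / m) *: normal gamma s - f s *: gamma s.

(** By the Frenet equations, the derivative of the vector is
    (f'' - f - k^2 f / m) gamma' + (k f' + (k f)' / m) N, and both coefficients
    vanish. *)
Lemma axis_constant s t : I s -> I t -> axis_at s = axis_at t.
Proof.
move=> Is It; apply/rowP => i.
apply: (derive0_constant (f := fun r => axis_at r 0 i) I_itv) Is It => r Ir.
have dk := is_derive_scurv gamma_curve Ir.
have dw := is_derive_ptM (is_derive_ptM dk (df Ir)) (is_derive_cst m^-1 r 1).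
have := is_derive_ptB
  (is_derive_ptD (is_derive_ptM (df1 Ir) (is_derive_coord 0 i (is_derive_jet gamma_curve 1 Ir)))
    (is_derive_ptM dw (is_derive_coord 0 i (frenet_normal I_open gamma_curve Ir))))
  (is_derive_ptM (df Ir) (is_derive_coord 0 i (is_derive_jet gamma_curve 0 Ir))).
congr (is_derive _ _ _ _).
  by apply/funext => p; rewrite [RHS]mxE [X in _ = X + _]mxE [X in _ = X + _ + _]mxE
    [X in _ = _ + X + _]mxE [X in _ = _ + _ + X]mxE [X in _ = _ + _ - X]mxE.
rewrite (frenet_tangent I_open gamma_curve Ir).
rewrite [(_ + _ *: normal gamma r) 0 i]mxE [(_ *: normal gamma r) 0 i]mxE [(_ *: jet gamma 1 r) 0 i]mxE.
have aux T g N F F1 F2 K K1 : K1 * F = - (m + 1) * K * F1 -> F2 = F + K ^+ 2 * F / m ->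
    F2 * T + F1 * (g + K * N) + (((K1 * F + K * F1) * m^-1 + K * F * 0) * N +
      K * F * m^-1 * (- K * T)) - (F1 * g + F * T) = 0.
  by move=> -> ->; field; rewrite gt_eqF.
exact: aux (kf1E Ir) (f2E Ir).
Qed.

Lemma lorentz_axis s : I s -> lorentz (gamma s) (axis_at s) = f s.
Proof.
move=> Is; rewrite /axis_at -scaleNr !lorentzDr !lorentzZr.
have -> : lorentz (gamma s) (jet gamma 1 s) = 0 by exact: (jet01 I_open gamma_curve Is).
have -> : lorentz (gamma s) (normal gamma s) = 0 by rewrite lorentzC lorentz_cross.
have -> : lorentz (gamma s) (gamma s) = -1 by exact: (jet00 gamma_curve Is).
by ring.
Qed.

Lemma axis_unit s : I s -> lorentz (axis_at s) (axis_at s) = 1.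
Proof.
move=> Is; rewrite /axis_at -scaleNr.
set g := gamma s; set t := jet gamma 1 s; set N := normal gamma s.
have gg : lorentz g g = -1 := jet00 gamma_curve Is.
have tt : lorentz t t = 1 := jet11 gamma_curve Is.
have gt : lorentz g t = 0 := jet01 I_open gamma_curve Is.
have NN : lorentz N N = 1 := normal_unit I_open gamma_curve Is.
have Ng : lorentz N g = 0 by rewrite lorentz_cross.
have Nt : lorentz N t = 0 by rewrite lorentz_cross.
move: (g) (t) (N) gg tt gt NN Ng Nt => {}g {}t {}N gg tt gt NN Ng Nt.
rewrite !lorentzDl !lorentzDr !lorentzZl !lorentzZr (lorentzC t g) (lorentzC t N) (lorentzC g N).
rewrite gg tt gt NN Ng Nt.
have := f1E Is; rewrite -/f1 -/f -/k -/m => E.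
transitivity (f1 s ^+ 2 + (k s * f s / m) ^+ 2 - f s ^+ 2); first by ring.
by rewrite E; ring.
Qed.

End Reconstruction.

(** * Isometries of the hyperbolic plane *)

Section Isometry.
Variable R : realType.

Lemma rsubmx3 (p : 'rV[R]_(2 + 1)) : rsubmx p 0 0 = p 0 i2.
Proof. by rewrite mxE; congr (p 0 _); apply/val_inj; rewrite /= inordK. Qed.

(** A rotation about the time axis followed by a boost maps any unit spacelike
    vector to the one along the x_1-axis. With e = (rho c, rho s, h), where
    c^2 + s^2 = 1 and rho^2 = 1 + h^2, the three coordinates of the image of p are
    its inner products with e, with (- s, c, 0) and, up to sign, with
    (h c, h s, rho). *)
Lemma isometry_to_axis (e : 'rV[R]_(2 + 1)) : lorentz e e = 1 ->
  exists2 L : 'M[R]_(2 + 1), hyperbolic_isometry L &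
    forall p : 'rV[R]_(2 + 1), (p *m L) 0 i0 = lorentz p e.
Proof.
rewrite lorentz3E; set a := e 0 i0; set b := e 0 i1; set h := e 0 i2 => e1.
pose rho := Num.sqrt (1 + h ^+ 2).
have rho2 : rho ^+ 2 = 1 + h ^+ 2 by rewrite sqr_sqrtr // addr_ge0 // sqr_ge0.
have rho0 : 0 < rho by rewrite sqrtr_gt0 ltr_pwDl // sqr_ge0.
pose c := a / rho; pose s := b / rho.
have ra : a = rho * c by rewrite /c mulrC divfK ?gt_eqF.
have rb : b = rho * s by rewrite /s mulrC divfK ?gt_eqF.
have cs : c ^+ 2 + s ^+ 2 = 1.
  apply: (mulfI (lt0r_neq0 (exprn_gt0 2 rho0))).
  transitivity (a * a + b * b); first by rewrite ra rb; ring.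
  by rewrite mulr1 rho2; move: e1; lra.
(* p *m L pairs p with columns by the Euclidean product, hence the sign of h *)
pose L : 'M[R]_(2 + 1) := \matrix_i
  (if i == i0 then vec3 a (- s) (- h * c) else
   if i == i1 then vec3 b c (- h * s) else vec3 (- h) 0 rho).
have LE (p : 'rV[R]_(2 + 1)) j : (p *m L) 0 j =
    p 0 i0 * vec3 a (- s) (- h * c) 0 j + p 0 i1 * vec3 b c (- h * s) 0 j +
    p 0 i2 * vec3 (- h) 0 rho 0 j.
  rewrite mxE sum3E; congr (_ * _ + _ * _ + _ * _); rewrite mxE.
  + by rewrite eqxx.
  + by rewrite -!val_eqE /= !inordK.
  + by rewrite -!val_eqE /= !inordK.
have L0 (p : 'rV[R]_(2 + 1)) : (p *m L) 0 i0 = rho * (c * p 0 i0 + s * p 0 i1) - h * p 0 i2.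
  by rewrite LE !vec3E ra rb; ring.
have L1 (p : 'rV[R]_(2 + 1)) : (p *m L) 0 i1 = c * p 0 i1 - s * p 0 i0.
  by rewrite LE !vec3E; ring.
have L2 (p : 'rV[R]_(2 + 1)) : (p *m L) 0 i2 = rho * p 0 i2 - h * (c * p 0 i0 + s * p 0 i1).
  by rewrite LE !vec3E; ring.
have Liso (u v : 'rV[R]_(2 + 1)) : lorentz (u *m L) (v *m L) = lorentz u v.
  rewrite !lorentz3E !L0 !L1 !L2.
  transitivity ((rho ^+ 2 - h ^+ 2) * (c * u 0 i0 + s * u 0 i1) * (c * v 0 i0 + s * v 0 i1)
    + (c * u 0 i1 - s * u 0 i0) * (c * v 0 i1 - s * v 0 i0)
    - (rho ^+ 2 - h ^+ 2) * u 0 i2 * v 0 i2); first by ring.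
  rewrite rho2; transitivity ((c ^+ 2 + s ^+ 2) * (u 0 i0 * v 0 i0 + u 0 i1 * v 0 i1) - u 0 i2 * v 0 i2); first by ring.
  by rewrite cs; ring.
exists L; last by move=> p; rewrite L0 lorentz3E -/a -/b -/h ra rb; ring.
split=> // p [p1]; rewrite rsubmx3 => p2; split; first by rewrite Liso.
rewrite rsubmx3 L2.
move: p1; rewrite lorentz3E; move: (p 0 i0) (p 0 i1) (p 0 i2) p2 => x y z z0 p1.
set A := c * x + s * y.
have A2 : A ^+ 2 < z ^+ 2.
  have : A ^+ 2 + (c * y - s * x) ^+ 2 = z ^+ 2 - 1.
    transitivity ((c ^+ 2 + s ^+ 2) * (x * x + y * y)); first by rewrite /A; ring.
    by rewrite cs; move: p1; lra.
  have := sqr_ge0 (c * y - s * x); lra.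
have hA : (h * A) ^+ 2 < (rho * z) ^+ 2.
  rewrite !exprMn rho2; have := sqr_ge0 h; have := sqr_ge0 A; nra.
rewrite subr_gt0 ltNge; apply/negP => hr; move: hA; apply/negP; rewrite -leNgt.
by rewrite ler_sqr ?nnegrE // ?(le_trans _ hr) // mulr_ge0 // ltW.
Qed.

Variables (I : set R) (gamma : R -> 'rV[R]_(2 + 1)) (L : 'M[R]_(2 + 1)).
Hypotheses (I_open : open I) (gamma_curve : arc_length_curve I gamma)
  (L_iso : hyperbolic_isometry L).
Let delta s := gamma s *m L.

Lemma is_derive_mulmx (f : R -> 'rV[R]_(2 + 1)) (s : R) (df : 'rV[R]_(2 + 1)) :
  is_derive s 1 f df -> is_derive s 1 (fun r => f r *m L) (df *m L).
Proof.
move=> hf; apply: is_derive_mx => i j; rewrite mxE; under eq_fun do rewrite mxE.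
apply: is_derive_pt_sum => l.
have := is_derive_ptM (is_derive_coord i l hf) (is_derive_cst (L l j) s 1).
by rewrite mulr0 addr0.
Qed.

(** Derivability and value are proved together: the derivative of order l + 1 of
    the image is the derivative of a function known only on the open set I. *)
Lemma jet_isometry l s : I s -> is_derive s 1 (jet delta l) (jet gamma l.+1 s *m L) /\
  jet delta l s = jet gamma l s *m L.
Proof.
elim: l s => [|l IH] s Is.
  by split => //; exact: is_derive_mulmx (is_derive_jet gamma_curve 0 Is).
have E r : I r -> jet delta l.+1 r = jet gamma l.+1 r *m L.
  by move=> Ir; have [[_ <-] _] := IH r Ir; rewrite /jet derive1nS derive1E.
split; last exact: E.
apply: (is_derive_local I_open Is (fun r Ir => esym (E r Ir))).
exact: is_derive_mulmx (is_derive_jet gamma_curve l.+1 Is).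
Qed.

Lemma isometry_curve : arc_length_curve I delta.
Proof.
move=> s Is; have [_ [g1 g2] t1] := gamma_curve Is; split.
- by move=> l; have [[]] := jet_isometry l Is.
- by apply: L_iso.2.
- have [_ E] := jet_isometry 1 Is.
  by rewrite -[derive1 delta s]/(jet delta 1 s) E L_iso.1.
Qed.

Lemma isometry_curvature s : I s -> curvature delta s = curvature gamma s.
Proof.
move=> Is; have [_ E] := jet_isometry 2 Is.
have A : acceleration delta s = acceleration gamma s *m L.
  rewrite /acceleration -[derive1n 2 delta s]/(jet delta 2 s) E L_iso.1.
  by rewrite mulmxDl scalemxAl.
by rewrite /curvature A L_iso.1.
Qed.

End Isometry.

(** * The equivalence *)

Lemma same_sign_ratio (R : realType) (x y f g : R) : 0 < f -> 0 < g ->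
  x ^+ 2 = f ^+ 2 -> y ^+ 2 = g ^+ 2 -> 0 < y * x -> x = y / g * f.
Proof.
move=> f0 g0 xf yg yx; have gn0 : g != 0 by rewrite gt_eqF.
have prod0 : (x * g - y * f) * (x * g + y * f) = 0.
  transitivity (x ^+ 2 * g ^+ 2 - y ^+ 2 * f ^+ 2); first by ring.
  by rewrite xf yg; ring.
have sum0 : x * g + y * f != 0.
  apply/eqP => h; have : 0 < y * x * g by rewrite mulr_gt0.
  have -> : y * x * g = y * (x * g + y * f) - y ^+ 2 * f by ring.
  by rewrite h mulr0 sub0r oppr_gt0 ltNge mulr_ge0 ?sqr_ge0 // ltW.
move/eqP: prod0; rewrite mulf_eq0 (negPf sum0) orbF subr_eq0 => /eqP h.
by apply: (mulIf gn0); rewrite h; field.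
Qed.

Section Main.
Variables (R : realType) (n : nat) (I : set R) (gamma : R -> 'rV[R]_(2 + 1)).
Hypotheses (n_gt0 : (0 < n)%N) (I_open : open I) (I_itv : is_interval I)
  (gamma_curve : arc_length_curve I gamma).

(** A point where the second form is nonzero provides the nonzero value of the
    first integral of the profile equation. *)
Lemma minimal_euler_lagrange : ~ totally_geodesic n I gamma -> minimal n I gamma ->
  exists a : R, [/\ 0 < a, euler_lagrange n a I gamma
    & warped_product n I gamma (warping n a gamma)].
Proof.
move=> ntg /(minimal_profile n_gt0 I_open gamma_curve) prof.
have [s [Is xs ks]] := not_totally_geodesic n_gt0 I_open gamma_curve ntg.
pose a := profile_a n gamma s; exists a.
have a0 : 0 < a := profile_a_gt0 n_gt0 prof Is xs ks.
have EL := profile_euler_lagrange n_gt0 I_open I_itv gamma_curve prof Is xs ks.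
split=> //; apply/(warped_product_sqr n_gt0 I_open gamma_curve) => r Ir.
split; last exact: (profile_warping n_gt0 I_open I_itv gamma_curve prof Is xs ks).
by apply: warping_gt0 => //; case: EL => h _ _; exact: h.
Qed.

(** The metric only determines x up to sign; the sign is constant because x has no
    zeros on the interval. *)
Lemma euler_lagrange_minimal (a : R) : 0 < a -> euler_lagrange n a I gamma ->
  warped_product n I gamma (warping n a gamma) -> minimal n I gamma.
Proof.
move=> a0 EL /(warped_product_sqr n_gt0 I_open gamma_curve) W.
apply/(minimal_profile n_gt0 I_open gamma_curve).
have [_ [s0 [_ [Is0 _ _]]] _] := EL.
pose x s : R := jet gamma 0 s 0 i0; pose f := warping n a gamma.
have dx s (Is : I s) := is_derive_coord 0 i0 (is_derive_jet gamma_curve 0 Is).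
have x0 s : I s -> x s != 0.
  by move=> Is; have [f0 xf] := W s Is; rewrite -sqrf_eq0 xf expf_neq0 ?gt_eqF.
have cx s : I s -> {for s, continuous x} by move=> Is; exact: is_derive_continuous (dx s Is).
have xx := nonvanishing_sign I_itv cx x0 Is0.
have [f00 xf0] := W s0 Is0.
apply: (warping_profile n_gt0 I_open I_itv gamma_curve a0 EL (e := x s0 / f s0) gamma_curve (fun s _ => erefl)) => s Is.
have [f0 xf] := W s Is.
exact: same_sign_ratio f0 f00 xf xf0 (xx s Is).
Qed.

(** The axis vector of a solution is constant and unit. The isometry that maps it
    to the x_1-axis turns the warping function into the first coordinate. *)
Lemma euler_lagrange_congruent (a : R) : 0 < a -> euler_lagrange n a I gamma ->
  exists L : 'M[R]_(2 + 1), [/\ hyperbolic_isometry L,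
    minimal n I (fun s => gamma s *m L)
  & warped_product n I (fun s => gamma s *m L) (warping n a gamma)].
Proof.
move=> a0 EL; have [k0 [s0 [_ [Is0 _ _]]] _] := EL.
have eu := axis_unit n_gt0 I_open gamma_curve a0 EL Is0.
have [L L_iso Lx] := isometry_to_axis eu.
have dc := isometry_curve I_open gamma_curve L_iso.
have xE s : I s -> jet (fun s => gamma s *m L) 0 s 0 i0 = warping n a gamma s.
  move=> Is; rewrite -[LHS]/((gamma s *m L) 0 i0) Lx.
  rewrite (axis_constant n_gt0 I_open I_itv gamma_curve a0 EL Is0 Is).
  exact: (lorentz_axis n a I_open gamma_curve Is).
exists L; split=> //.
  apply/(minimal_profile n_gt0 I_open dc).
  apply: (warping_profile n_gt0 I_open I_itv gamma_curve a0 EL (e := 1) dc) => s Is.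
    exact: isometry_curvature I_open gamma_curve L_iso s Is.
  by rewrite xE // mul1r.
apply/(warped_product_sqr n_gt0 I_open dc) => s Is; split; last by rewrite xE.
exact: (warping_gt0 n_gt0 a0 (k0 s Is)).
Qed.

(** The constant a can be read off from the equation at one point, because u is
    positive there. *)
Lemma euler_lagrange_unique (a b : R) : euler_lagrange n a I gamma -> euler_lagrange n b I gamma -> a = b.
Proof.
move=> [k0 [s [_ [Is _ _]]] Ea] [_ _ Eb].
have u0 : 0 < u_of n gamma s := u_of_gt0 n (k0 s Is).
have [_ E1] := Ea s Is; have [_ E2] := Eb s Is.
move: E2; rewrite E1 => {E1 Ea Eb}.
have m0 : (2 * n%:R - 1 : R) != 0 by rewrite gt_eqF // m_gt0.
have n0 : (n%:R : R) != 0 by rewrite pnatr_eq0 -lt0n.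
have c0 : 4 * u_of n gamma s ^+ 2 / (2 * n%:R - 1) ^+ 2 != 0.
  apply: mulf_neq0 (mulf_neq0 _ (expf_neq0 2 (lt0r_neq0 u0))) (invr_neq0 (expf_neq0 2 m0)).
  by rewrite pnatr_eq0.
move=> /(mulfI c0) /addIr /addrI /(mulIf (lt0r_neq0 u0)).
by apply: mulfI; rewrite !mulf_neq0 ?expf_neq0.
Qed.

End Main.

Theorem theorem3p2 (R : realType) (n : nat) (I : set R)
    (gamma : R -> 'rV[R]_(2 + 1)) (n_gt0 : (0 < n)%N)
    (I_open : open I) (I_itv : is_interval I)
    (gamma_curve : arc_length_curve I gamma)
    (M_not_tg : ~ totally_geodesic n I gamma) :
  let p : R := (2 * n%:R - 1) / (2 * n%:R) in
  1 / 2 <= p < 1 /\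
  (minimal n I gamma <->
   exists a : R,
     [/\ 0 < a, euler_lagrange n a I gamma
       & warped_product n I gamma (warping n a gamma)]) /\
  (forall a : R, 0 < a -> euler_lagrange n a I gamma ->
     [/\ minimal n I gamma -> warped_product n I gamma (warping n a gamma),
         exists L : 'M[R]_(2 + 1),
           [/\ hyperbolic_isometry L,
               minimal n I (fun s => gamma s *m L)
             & warped_product n I (fun s => gamma s *m L) (warping n a gamma)]
       & forall s, I s ->
           warping n a gamma s =
           (2 * n%:R - 1) /
           (2 * n%:R * Num.sqrt a * Num.sqrt (u_of n gamma s))]).
Proof.
move=> p; split; last split.
- have n1 : (1 : R) <= n%:R by rewrite ler1n.
  have n2 : 0 < 2 * n%:R :> R by lra.
  by rewrite /p ler_pdivlMr // ltr_pdivrMr //; apply/andP; split; lra.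
- split=> [mini|[a [a0 EL W]]]; first exact: minimal_euler_lagrange.
  exact: euler_lagrange_minimal EL W.
- move=> a a0 EL; split.
  + move=> /(minimal_euler_lagrange n_gt0 I_open I_itv gamma_curve M_not_tg) [b [_ ELb]].
    by rewrite (euler_lagrange_unique n_gt0 EL ELb).
  + exact: euler_lagrange_congruent.
  + by move=> s _; exact: warping_u.
Qed.
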